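(* For any interval $(A,A+N]\subseteq(0,\infty)$, uniformly over $N\ge\exp(3x/\log\log x)$, we have $$\#\left(\mathcal{S}_x\cap(A,A+N]\right)=(1+o(1))\frac{N}{M(x)}\,\#\left(\mathcal{S}_x\cap(0,M(x)]\right),\qquad x\to\infty.$$ That is, for every $\varepsilon>0$ there is $x_0$ such that for all real $x\ge x_0$, all real $A\ge 0$ and all real $N\ge \exp(3x/\log\log x)$, $$\left|\#\left(\mathcal{S}_x\cap(A,A+N]\right)-\frac{N}{M(x)}\#\left(\mathcal{S}_x\cap(0,M(x)]\right)\right|\le\varepsilon\,\frac{N}{M(x)}\#\left(\mathcal{S}_x\cap(0,M(x)]\right).$$
   Context: For a real number $x$, $M(x)$ denotes the product of all primes $p\le x$. An $x$-pseudosquare is a positive integer $n$ that is not a perfect square, satisfies $n\equiv 1\pmod 8$, and satisfies $\left(\frac{n}{p}\right)=1$ (Legendre symbol) for each odd prime $p\le x$. $\mathcal{S}_x$ denotes the set of all $x$-pseudosquares. *)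

(* Defs.v *)
(* MathComp / MathComp-Analysis world. *)
From mathcomp Require Import all_boot all_order all_algebra finmap.
From mathcomp Require Import all_classical all_reals all_analysis.

Set Implicit Arguments.
Unset Strict Implicit.
Unset Printing Implicit Defensive.

Import Order.TTheory GRing.Theory Num.Theory.

Local Open Scope classical_set_scope.
Local Open Scope ring_scope.

(* Legendre symbol (a/p), meaningful for p an odd prime; the ordinals y : 'I_p
   run through a complete residue system mod p. *)
Definition legendre (a : int) (p : nat) : int :=
  if (p %| a)%Z then 0
  else if [exists y : 'I_p, ((y : nat)%:Z ^+ 2 == a %[mod p])%Z] then 1
  else -1.

(* For x >= 0, p <= Num.truncn x iff p%:R <= x. *)
Definition primorial (R : realType) (x : R) : nat :=
  (\prod_(0 <= p < (Num.truncn x).+1 | prime p) p)%N.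

Definition is_pseudosquare (R : realType) (x : R) (n : nat) : Prop :=
  [/\ (0 < n)%N,
      ~ (exists m : nat, n = (m ^ 2)%N),
      n = 1 %[mod 8]
    & forall p : nat, prime p -> odd p -> p%:R <= x -> legendre n%:Z p = 1].

Definition pseudosquares (R : realType) (x : R) : set nat :=
  [set n | is_pseudosquare x n].

Definition nat_oc (R : realType) (a b : R) : set nat :=
  [set n | a < n%:R <= b].

(* Bounded, so that fset_set (which sends infinite sets to fset0) keeps all
   elements in pseudosquare_count. *)
Lemma finite_nat_oc (R : realType) (a b : R) : finite_set (nat_oc a b).
Proof.
apply: (sub_finite_set _ (finite_II (Num.truncn b).+1)) => n /= /andP[_ nb].
by rewrite ltnS truncn_ge_nat// (le_trans _ nb).
Qed.

Definition pseudosquare_count (R : realType) (x a b : R) : nat :=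
  #|` fset_set (pseudosquares x `&` nat_oc a b)|%N.

(* Main.v *)
Require Import Defs.
From mathcomp Require Import all_boot all_order all_algebra finmap.
From mathcomp Require Import all_classical all_reals all_analysis.
From mathcomp Require Import all_field.
From mathcomp Require Import zify ring lra.

(** Write L = 3 x / log log x.  It is enough to show that an interval of length
    N >= e^L contains (1 + o(1)) N d pseudosquares, where
    d = 2^-t (1/8) prod (1 - 1/p) is the density of the n that are 1 modulo 8 and a
    nonzero square modulo each of the t odd primes p <= x.  By Chebyshev's lower
    bound the product of the primes up to x exceeds e^L, so the interval from 0
    to that product is of the admitted length too, and the two counts can be
    compared (ratio_compare).  The interval contains at most about sqrt N
    perfect squares, which is negligible.

    The indicator of the residue pattern is the product over p of
    (chi_p + chi_p^2) / 2, where chi_p is the Legendre symbol.  Expanding it gives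
    2^t sums over the interval, one for each set D of primes that carry chi_p, the
    others carrying chi_p^2, that is, coprimality to p (residue_pattern_expand).
    The empty set gives the main term N d by Legendre's sieve.  As t = O(x / log x),
    while d >= 4^-t / 8, every other sum must be shown to be at most 4 w N, where
    w = exp (-10 x / log x): a saving which is far smaller than any power of N, but
    for conductors as large as e^x.

    If the product of the primes of D is at most about e^(L/4), the mean of a
    nontrivial character over a period is zero and the sieve suffices
    (twisted_sum_small).  Otherwise all the moduli are at most x, so that D contains
    a set of large primes whose product s is within a factor x of Y = e^(L/4), and
    the remaining moduli can be grouped into k factors r_i of size at most
    Z = e^(L/2).  Shifting n by multiples of r_i and applying Cauchy's inequality
    removes the factor of period r_i (weyl_differencing); after k steps only the
    complete sum modulo s is left, of a product of 2^k Legendre symbols over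
    the vertices of a cube, averaged over the cubes.  Since log 4 < 3/2, the number
    of steps is at most log log x, and 2^k <= (log x)^0.74.  The
    differencing takes a 2^k-th root, and so turns the bound s^-1/4 for the averaged
    complete sum into one below w.

    The averages over cubes factor over the primes of s (cube_mean_crt), and at one
    prime p they are controlled by two facts.  A vertex of a random cube coincides
    with another one with probability at most 2^k / p.  When it does not, the
    product of linear factors has a simple root, and Weil's bound applies, in a
    form with a worse constant that Stepanov's polynomial method gives directly
    (sum_qchar_prod). *)

Set Implicit Arguments.
Unset Strict Implicit.
Unset Printing Implicit Defensive.

Import Order.TTheory GRing.Theory Num.Theory.
Local Open Scope ring_scope.

(** * Multiplicities of roots *)

Lemma derivn_XsubC_mul (F : comNzRingType) (a : F) (Q : {poly F}) k :
  (('X - a%:P) * Q)^`(k.+1) = ('X - a%:P) * Q^`(k.+1) + Q^`(k) *+ k.+1.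
Proof.
elim: k => [|k IH]; first by rewrite !derivn1 derivn0 derivM derivXsubC mul1r addrC.
rewrite derivnS IH derivD derivM derivXsubC mul1r derivMn -!derivnS.
by rewrite [RHS]addrC (mulrS _ k.+1) addrAC.
Qed.

(** If P = (X - a) Q, the k-th derivative of P at a is k times the derivative of order
    k - 1 of Q, and k is invertible as long as k < p. *)
Lemma dvdp_exp_XsubC_derivn (F : fieldType) (p : nat) (P : {poly F}) (a : F)
    (l : nat) :
  p \in [pchar F] -> (l <= p)%N -> (forall k, (k < l)%N -> P^`(k).[a] = 0) ->
  ('X - a%:P) ^+ l %| P.
Proof.
move=> pF; elim: l P => [|l IH] P lp Pk0; first by rewrite expr0 dvd1p.
have /factor_theorem[Q PE] : root P a by rewrite /root -[P]derivn0 Pk0.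
rewrite PE exprSr dvdp_mul2r ?polyXsubC_eq0//; apply: IH; first exact: ltnW.
move=> k kl; have /eqP := Pk0 k.+1 kl.
rewrite PE mulrC derivn_XsubC_mul hornerD hornerM !hornerE subrr mul0r add0r.
rewrite hornerMn -mulr_natr mulf_eq0 => /orP[/eqP//|].
by rewrite -(dvdn_pcharf pF) => /dvdn_leq; lia.
Qed.

Lemma count_roots_multiplicity (F : fieldType) (P : {poly F}) (l : nat)
    (s : seq F) :
  P != 0 -> uniq s -> (forall a, a \in s -> ('X - a%:P) ^+ l %| P) ->
  (l * size s < size P)%N.
Proof.
move=> P0 us sP.
have : \prod_(a <- s) ('X - a%:P) ^+ l %| P.
  elim: s us sP => [|a s IH] /=; first by rewrite big_nil dvd1p.
  move=> /andP[as_ us] sP; rewrite big_cons Gauss_dvdp.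
    by rewrite sP ?mem_head// IH// => b bs; rewrite sP// inE bs orbT.
  rewrite big_seq; apply: (big_ind (fun Q => coprimep _ Q)) => //.
  - exact: coprimep1.
  - by move=> Q R; rewrite coprimepMr => -> ->.
  - move=> b bs; apply: coprimep_expl; apply: coprimep_expr.
    apply: coprimep_XsubC2; rewrite subr_eq0; apply: contraNneq as_ => <-//.
move=> /dvdp_leq; rewrite P0 => /(_ isT); rewrite prodrXl.
have := size_exp (\prod_(a <- s) ('X - a%:P)) l; rewrite size_prod_XsubC /=.
have : (0 < size P)%N by rewrite size_poly_gt0.
by rewrite mulnC; case: (size (polyseq (_ ^+ l))) => [|n]/= P_ <-; rewrite ?ltnS.
Qed.

(** Compare the parities of the multiplicities of a on both sides. *)
Lemma simple_root_nonsquare (F : fieldType) (f r s : {poly F}) (a c : F) :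
  ~~ root f a -> c != 0 ->
  ('X - a%:P) * f * r ^+ 2 = c%:P * s ^+ 2 -> r = 0 /\ s = 0.
Proof.
move=> fa c0 E.
have X0 : 'X - a%:P != 0 by rewrite polyXsubC_eq0.
have f0 : f != 0 by apply: contraNneq fa => ->; rewrite root0.
have cP : c%:P != 0 :> {poly F} by rewrite polyC_eq0.
have rs : (r == 0) = (s == 0).
  move: (congr1 (fun P => P == 0) E).
  by rewrite !mulf_eq0 (negbTE X0) (negbTE f0) (negbTE cP) !orFb !orbb.
have [r0|r0] := eqVneq r 0; first by split=> //; apply/eqP; rewrite -rs r0.
exfalso; have s0 : s != 0 by rewrite -rs.
have := congr1 (mup a) E; rewrite !expr2.
rewrite !mupM ?mulf_neq0 ?expf_neq0// (mupNroot fa).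
rewrite (@mup_XsubCX _ 1%N) eqxx (mupNroot (q := c%:P)) ?rootC//.
by lia.
Qed.

(** * Stepanov's method *)

(** The nonvanishing step of Stepanov's method.  Put g = ('X - a%:P) * f.  As g^p is
    congruent to the nonzero constant c modulo X^p, the blocks of index 0 satisfy
    g r_0^2 = c s_0^2 modulo X^p, hence exactly because of the degrees, and the
    simple root a forbids that; then divide by X^(2p) and repeat. *)
Lemma stepanov_blocks_eq0 (F : fieldType) (p B J : nat) (f h : {poly F}) (a c : F)
    (r s : nat -> {poly F}) :
  ~~ root f a -> c != 0 ->
  (('X - a%:P) * f) ^+ p = c%:P + 'X^p * h ->
  (forall j, size (r j) <= B)%N -> (forall j, size (s j) <= B)%N ->
  (0 < B)%N -> (2 * B + size f <= p)%N ->
  ('X - a%:P) * f * (\sum_(j < J) r j * 'X^(j * p)) ^+ 2 =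
    (('X - a%:P) * f) ^+ p * (\sum_(j < J) s j * 'X^(j * p)) ^+ 2 ->
  forall j, (j < J)%N -> r j = 0 /\ s j = 0.
Proof.
move=> fa c0 fp; elim: J r s => [|J IH] r s rB sB B0 Bp E j; first by [].
have f0 : f != 0 by apply: contraNneq fa => ->; rewrite root0.
have X0 : 'X - a%:P != 0 by rewrite polyXsubC_eq0.
have split_sum (t : nat -> {poly F}) : \sum_(j < J.+1) t j * 'X^(j * p) =
    t 0%N + 'X^p * \sum_(j < J) t j.+1 * 'X^(j * p).
  rewrite big_ord_recl mul0n expr0 mulr1 mulr_sumr; congr (_ + _).
  apply: eq_bigr => i _; rewrite lift0 mulSn exprD mulrCA; congr (_ * _).
set g := ('X - a%:P) * f in fp E *.
have := E; rewrite !split_sum.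
set R := \sum_(j < J) _; set S := \sum_(j < J) _ => E'.
have szle (t : {poly F}) : (size t <= B)%N -> (size (t ^+ 2) <= (2 * B).-1)%N.
  by move=> tB; have := size_polyMleq t t; rewrite expr2; lia.
have D0 : g * r 0%N ^+ 2 - c%:P * s 0%N ^+ 2 = 0.
  apply/eqP; apply: contraTT isT => D0.
  have : 'X^p %| g * r 0%N ^+ 2 - c%:P * s 0%N ^+ 2.
    apply/dvdpP; exists (g ^+ p * (2%:R * s 0%N * S + 'X^p * S ^+ 2) + h * s 0%N ^+ 2
      - g * (2%:R * r 0%N * R + 'X^p * R ^+ 2)).
    have : g * (r 0%N + 'X^p * R) ^+ 2 - (c%:P + 'X^p * h) * (s 0%N + 'X^p * S) ^+ 2 = 0.
      by rewrite -fp E' subrr.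
    rewrite fp => H; apply/eqP; rewrite -subr_eq0 -[X in _ == X]H; apply/eqP; ring.
  move=> /dvdp_leq; rewrite D0 size_polyXn => /(_ isT).
  have sg : size g = (size f).+1.
    by rewrite /g size_monicM ?monicXsubC// size_XsubC.
  have := size_polyD (g * r 0%N ^+ 2) (- (c%:P * s 0%N ^+ 2)).
  rewrite size_polyN => h1.
  have := size_polyMleq g (r 0%N ^+ 2); have := szle _ (rB 0%N).
  have := size_polyMleq c%:P (s 0%N ^+ 2); have := szle _ (sB 0%N).
  have := size_polyC_leq1 c.
  have : (0 < size f)%N by rewrite size_poly_gt0.
  move=> f1 c1 s1 cs r1 gr pl; exfalso; move: (leq_trans pl h1).
  rewrite leq_max => /orP[/leq_trans/(_ gr)|/leq_trans/(_ cs)]; move: sg r1 s1 c1 Bp B0 f1.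
    by move: (size (polyseq g)) (size (polyseq (r 0%N ^+ 2))) (size (polyseq f)) => x y z; lia.
  by move: (size (polyseq c%:P)) (size (polyseq (s 0%N ^+ 2))) (size (polyseq f)) => x y z; lia.
have [r0 s0] : r 0%N = 0 /\ s 0%N = 0.
  by apply: (simple_root_nonsquare fa c0); apply/eqP; rewrite -subr_eq0; apply/eqP.
case: j => [|j]; first by move=> _.
rewrite ltnS; apply: (IH (fun j => r j.+1) (fun j => s j.+1)) => //.
have Xp : ('X^p : {poly F}) ^+ 2 != 0 by rewrite expf_neq0// monic_neq0 ?monicXn.
apply: (mulfI Xp); move: E'; rewrite r0 s0 !add0r !exprMn => E'.
by move: E'; rewrite mulrCA [RHS]mulrCA.
Qed.

(** The cofactor of f^(m-k) in the k-th derivative of f^m r. *)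
Fixpoint deriv_cofactor (F : nzRingType) (f : {poly F}) (m k : nat) (r : {poly F}) :=
  if k is k'.+1 then
    let t := deriv_cofactor f m k' r in f^`() * t *+ (m - k') + f * t^`()
  else r.

Lemma deriv_cofactorE (F : comNzRingType) (f : {poly F}) m k r : (k <= m)%N ->
  (f ^+ m * r)^`(k) = f ^+ (m - k) * deriv_cofactor f m k r.
Proof.
elim: k => [|k IH] km; first by rewrite derivn0 subn0.
rewrite derivnS IH; last exact: ltnW.
have -> : (m - k = (m - k.+1).+1)%N by lia.
rewrite derivM deriv_exp /= exprS.
have -> : (m - k = (m - k.+1).+1)%N by lia.
by rewrite mulrDr !mulrnAl !mulrnAr; congr (_ *+ _ + _); ring.
Qed.

Lemma deriv_cofactorB (F : nzRingType) (f : {poly F}) m k r s :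
  deriv_cofactor f m k (r - s) = deriv_cofactor f m k r - deriv_cofactor f m k s.
Proof.
by elim: k => [|k IH] //=; rewrite IH derivB !mulrBr mulrnBl opprD addrACA.
Qed.

Lemma size_deriv_le (F : nzRingType) (t : {poly F}) : (size t^`() <= (size t).-1)%N.
Proof.
have [->|t0] := eqVneq t 0; first by rewrite deriv0 size_poly0.
by have := lt_size_deriv t0; lia.
Qed.

Lemma size_deriv_cofactor (F : nzRingType) (f : {poly F}) m k r :
  (0 < size f)%N -> (size (deriv_cofactor f m k r) <= size r + k * (size f).-1)%N.
Proof.
move=> f0; elim: k => [|k IH] /=; first by rewrite mul0n addn0.
set t := deriv_cofactor _ _ _ _ in IH *.
have [->|t0] := eqVneq t 0.
  by rewrite mulr0 mul0rn deriv0 mulr0 addr0 size_poly0.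
have h1 := size_polyD (f^`() * t *+ (m - k)) (f * t^`()).
apply: leq_trans h1 _; rewrite geq_max.
have tp : (0 < size t)%N by rewrite size_poly_gt0.
apply/andP; split.
  have h2 : (size (f^`() * t *+ (m - k)) <= size (f^`() * t)%R)%N.
    by rewrite -scaler_nat; apply: size_scale_leq.
  apply: leq_trans h2 _; apply: leq_trans (size_polyMleq _ _) _.
  have := size_deriv_le f; rewrite mulSn.
  have H x y z u : (x <= y -> z <= size r + u -> (x + z).-1 <= size r + (y + u))%N by lia.
  by move=> /H; apply.
apply: leq_trans (size_polyMleq _ _) _.
have := size_deriv_le t; rewrite mulSn.
have H x y z u : (0 < z -> x <= y.-1 -> 0 < y -> y <= size r + u ->
    (z + x).-1 <= size r + (z.-1 + u))%N by lia.
by move=> h2; apply: (H _ (size t)) => //.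
Qed.

(** The powers of X^p are constants for the derivative; this is why the auxiliary
    polynomial is assembled from blocks multiplied by them. *)
Lemma derivn_mul_Xnp (F : comNzRingType) p (A : {poly F}) j k :
  p \in [pchar F] -> (A * 'X^(j * p))^`(k) = A^`(k) * 'X^(j * p).
Proof.
move=> pF; elim: k => [|k IH]; first by rewrite !derivn0.
have -> : (A * 'X^(j * p))^`(k.+1) = (A * 'X^(j * p))^`(k)^`() by rewrite derivnS.
rewrite IH derivM derivXn -mulr_natr natrM.
have -> : p%:R = 0 :> {poly F} by apply: pcharf0; rewrite pchar_poly.
by rewrite !mulr0 addr0 -derivnS.
Qed.

(** The degree count of stepanov_bound, with sizes of polynomials replaced by plain
    numbers. *)
Lemma stepanov_degree (P X Y R GS G S lD hD J1p B p Jp : nat) :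
  (P <= (X + Y).-1 -> Y <= maxn R GS -> GS <= (G + S).-1 -> X <= lD.+1 ->
   G <= hD.+1 -> R <= B + J1p -> S <= B + J1p -> J1p + p = Jp -> B <= p ->
   P <= lD + hD + Jp)%N.
Proof. lia. Qed.

Section Stepanov.

Variables (p : nat) (p_pr : prime p) (p_odd : odd p).
Notation F := 'F_p.

Variables (a : F) (f1 h : {poly F}) (c eps : F).
Hypotheses (f1a : ~~ root f1 a) (c0 : c != 0).
Let f := ('X - a%:P) * f1.
Let D := size f1.
Hypothesis fp : f ^+ p = c%:P + 'X^p * h.
Variable m : nat.
Hypotheses (m_gt0 : (0 < m)%N) (mp : (9 * m ^ 2 + D + 1 < p)%N).

(* l is the order of vanishing and J the number of blocks; the choice J = m + D makes
   the 2 J B coefficients outnumber the l M linear conditions. *)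
Let l := (2 * m)%N.
Let J := (m + D)%N.
Let B := ((p - D) %/ 2)%N.
Let M := (B + l * D + J)%N.
Let l' := (l + (p - 1) %/ 2)%N.

Let f1_neq0 : f1 != 0. Proof. by apply: contraNneq f1a => ->; rewrite root0. Qed.
Let D_gt0 : (0 < D)%N. Proof. by rewrite size_poly_gt0. Qed.
Let f_neq0 : f != 0. Proof. by rewrite mulf_neq0 ?polyXsubC_eq0. Qed.
Let size_f : size f = D.+1.
Proof. by rewrite /f size_monicM ?monicXsubC// size_XsubC. Qed.
Let p_ge : (9 * m * m + D + 1 < p)%N. Proof. by move: mp; rewrite expnS expn1 mulnA. Qed.
Let m2 : (m <= m * m)%N. Proof. by rewrite leq_pmull. Qed.

(** At a point z with z^p = z and f(z)^((p-1)/2) = eps, the k-th derivative of the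
    auxiliary polynomial is a power of f(z) times the value of this polynomial of
    degree less than M. *)
Let cond (rs : 'M[F]_(J, B) * 'M[F]_(J, B)) (k : nat) : {poly F} :=
  \sum_(j < J) (deriv_cofactor f l k (rVpoly (row j rs.1))
     + eps *: deriv_cofactor f l' k (rVpoly (row j rs.2))) * 'X^j.

Let size_cond rs k : (k < l)%N -> (size (cond rs k) <= M)%N.
Proof.
move=> kl; apply: leq_trans (size_sum _ _ _) _; apply/bigmax_leqP => j _.
have kD : (k * D + D <= l * D)%N by rewrite -mulSnr leq_mul2r kl orbT.
have sz (e : nat) (v : 'rV[F]_B) : (size (deriv_cofactor f e k (rVpoly v)) <= B + k * D)%N.
  have f0 : (0 < size f)%N by rewrite size_f.
  apply: leq_trans (size_deriv_cofactor _ _ _ f0) _; rewrite size_f /=.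
  by rewrite leq_add2r size_poly.
set t := (X in X * _); have st : (size t <= B + k * D)%N.
  apply: leq_trans (size_polyD _ _) _; rewrite geq_max sz /=.
  by apply: leq_trans (size_scale_leq _ _) _.
apply: leq_trans (size_polyMleq _ _) _; rewrite size_polyXn /M.
have H x : (x <= B + k * D -> (x + j.+1).-1 <= B + l * D + J)%N.
  by have := ltn_ord j; lia.
exact: H.
Qed.

Let condB rs rs' k : cond (rs.1 - rs'.1, rs.2 - rs'.2) k = cond rs k - cond rs' k.
Proof.
rewrite /cond -sumrB; apply: eq_bigr => j _ /=.
rewrite !linearB /= !deriv_cofactorB -mulrBl scalerBr; congr (_ * _).
by rewrite opprD addrACA.
Qed.

(** Pigeonhole in place of linear algebra: two pairs with the same conditions differ
    by a nonzero solution. *)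
Let exists_solution : exists2 rs, rs != (0, 0) & forall k, (k < l)%N -> cond rs k = 0.
Proof.
pose Phi rs := \matrix_(k < l) (poly_rV (cond rs k) : 'rV[F]_M).
have /injectivePn[rs [rs' ne E]] : ~~ injectiveb Phi.
  apply/negP => /injectiveP/leq_card; rewrite card_prod !card_mx !card_Fp//.
  rewrite -expnD leqNgt ltn_exp2l ?prime_gt1//.
  apply/negP; rewrite negbK /M /l /J.
  have B9 : (p <= 2 * B + D + 1)%N by rewrite /B; lia.
  have DB : (D * (9 * m * m) + D <= 2 * (D * B))%N.
    have : (9 * m * m + 1 <= 2 * B)%N by lia.
    by rewrite -(leq_pmul2l D_gt0) mulnDr muln1 (mulnCA D 2%N); lia.
  have : (m * m <= D * (m * m))%N by rewrite leq_pmull.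
  have : (D * m <= D * (m * m))%N by rewrite leq_mul2l m2 orbT.
  lia.
exists (rs.1 - rs'.1, rs.2 - rs'.2).
  apply: contraNneq ne => -[/eqP + /eqP]; rewrite !subr_eq0 => /eqP + /eqP.
  by case: rs rs' {E} => [u v] [u' v'] /= -> ->.
move=> k kl; rewrite condB.
have := congr1 (fun A => rVpoly (row (Ordinal kl) A)) E.
by rewrite !rowK /= !poly_rV_K ?size_cond// => ->; rewrite subrr.
Qed.

(** A nonzero auxiliary polynomial vanishing to order l = 2m at every point of the
    level set; comparing its degree with l bounds the size of that set. *)
Lemma stepanov_bound (s : seq F) :
  uniq s -> (forall z, z \in s -> f.[z] ^+ ((p - 1) %/ 2) = eps) ->
  (2 * m * size s <= 2 * m * D + D * ((p - 1) %/ 2) + (m + D) * p)%N.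
Proof.
move=> us sE.
have [rs rs0 condE] := exists_solution.
pose r (j : nat) := if insub j is Some i then rVpoly (row (i : 'I_J) rs.1) else 0.
pose t (j : nat) := if insub j is Some i then rVpoly (row (i : 'I_J) rs.2) else 0.
have rE (j : 'I_J) : r j = rVpoly (row j rs.1) by rewrite /r valK.
have tE (j : 'I_J) : t j = rVpoly (row j rs.2) by rewrite /t valK.
have rB j : (size (r j) <= B)%N.
  by rewrite /r; case: insubP => [i _ _|_]; rewrite ?size_poly// size_poly0.
have tB j : (size (t j) <= B)%N.
  by rewrite /t; case: insubP => [i _ _|_]; rewrite ?size_poly// size_poly0.
have B_gt0 : (0 < B)%N by rewrite /B; move: p_ge; clear; lia.
pose R := \sum_(j < J) r j * 'X^(j * p).
pose S := \sum_(j < J) t j * 'X^(j * p).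
pose g := f ^+ ((p - 1) %/ 2).
have gp : f * g ^+ 2 = f ^+ p.
  rewrite /g -exprM -exprS; congr (_ ^+ _).
  by move: p_odd (prime_gt0 p_pr); clear; lia.
(* g is a square root of f^(p-1), so R = - g S would give f R^2 = f^p S^2. *)
have RS0 : R + g * S != 0.
  apply: contra_neq rs0 => RS.
  have E : f * R ^+ 2 = f ^+ p * S ^+ 2.
    have -> : R = - (g * S) by apply/eqP; rewrite -addr_eq0 RS.
    by rewrite sqrrN exprMn mulrA gp.
  have H : (2 * B + size f1 <= p)%N by rewrite /B -/D; move: p_ge; clear; lia.
  have := stepanov_blocks_eq0 f1a c0 fp rB tB B_gt0 H E.
  move=> Z; rewrite [rs]surjective_pairing; congr (_, _).
    apply/row_matrixP => j; rewrite row0 -[LHS]rVpolyK -rE (Z j _).1 ?linear0//.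
  apply/row_matrixP => j; rewrite row0 -[LHS]rVpolyK -tE (Z j _).2 ?linear0//.
pose P := f ^+ l * (R + g * S).
have PE : P = \sum_(j < J) (f ^+ l * r j + f ^+ l' * t j) * 'X^(j * p).
  rewrite /P mulrDr /R /S mulr_sumr !mulr_sumr -big_split /=; apply: eq_bigr => j _.
  by rewrite /l' exprD /g mulrDl !mulrA.
have P0 : P != 0 by rewrite mulf_neq0 ?expf_neq0.
have pF := pchar_Fp p_pr.
have root_P z : z \in s -> ('X - z%:P) ^+ l %| P.
  move=> zs; have lp : (l <= p)%N by rewrite /l; move: p_ge m2; clear; lia.
  apply: (dvdp_exp_XsubC_derivn pF lp).
  move=> k kl; have := congr1 (fun Q => f.[z] ^+ (l - k) * Q.[z]) (condE k kl).
  rewrite horner0 mulr0 => <-.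
  have -> : P^`(k) = \sum_(j < J) (f ^+ (l - k) * deriv_cofactor f l k (r j)
       + f ^+ (l' - k) * deriv_cofactor f l' k (t j)) * 'X^(j * p).
    rewrite PE (big_morph (fun Q => Q^`(k)) (id1 := 0) (op1 := +%R)).
    - apply: eq_bigr => j _; rewrite derivn_mul_Xnp// derivnD !deriv_cofactorE//.
        exact: leq_trans (ltnW kl) (leq_addr _ _).
      exact: ltnW.
    - exact: derivnD.
    - by rewrite linear0.
  rewrite /cond !horner_sum mulr_sumr; apply: eq_bigr => j _.
  have -> : (l' - k = (l - k) + (p - 1) %/ 2)%N by apply/esym/addnBAC/ltnW.
  have fz : f.[z] = (z - a) * f1.[z] by rewrite hornerM !hornerE.
  have := sE z zs; rewrite fz => sz.
  have zp : z ^+ p = z by have := expf_card z; rewrite card_Fp.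
  rewrite -rE -tE !hornerE exprD sz (mulnC j) exprM zp.
  rewrite /=; ring.
apply: ltnW; apply: leq_trans (count_roots_multiplicity P0 us root_P) _.
have sfX n : (size (f ^+ n) <= (n * D).+1)%N.
  by apply: leq_trans (size_poly_exp_leq _ _) _; rewrite size_f /= mulnC.
have sRS (u : nat -> {poly F}) : (forall j, (size (u j) <= B)%N) ->
    (size (\sum_(j < J) u j * 'X^(j * p))%R <= B + (J - 1) * p)%N.
  move=> uB; apply: leq_trans (size_sum _ _ _) _; apply/bigmax_leqP => j _.
  apply: leq_trans (size_polyMleq _ _) _; rewrite size_polyXn.
  have : (j * p <= (J - 1) * p)%N 
    by rewrite leq_mul2r -ltnS subn1 prednK ?addn_gt0 ?m_gt0// ltn_ord orbT.
  by rewrite addnS /=; apply: leq_add.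
have sP := size_polyMleq (f ^+ l) (R + g * S).
have s1 := size_polyD R (g * S).
have s2 := size_polyMleq g S.
have s3 := sfX l; have s4 := sfX ((p - 1) %/ 2)%N.
have s5 := sRS _ rB; have s6 := sRS _ tB.
have JE : ((J - 1) * p + p = (m + D) * p)%N.
  by rewrite -mulSnr subn1 prednK // addn_gt0 m_gt0.
have Bp : (B <= p)%N by apply: leq_trans (leq_div _ _) (leq_subr _ _).
rewrite (mulnC D); exact: (stepanov_degree sP s1 s2 s3 s4 s5 s6 JE Bp).
Qed.

End Stepanov.

(** * The quadratic character *)

(** The quadratic character of F_p, by Euler's criterion. *)
Definition qchar (p : nat) (z : 'F_p) : int :=
  if z == 0 then 0 else if z ^+ ((p - 1) %/ 2) == 1 then 1 else -1.

(** u, v and w stand for the sizes of three sets that fill a set of p elements, the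
    first small and the others of at most about p / 2 elements. *)
Lemma level_set_gap (m D p u v w h : nat) :
  (0 < m)%N -> (9 * m ^ 2 + D + 1 < p)%N -> (u <= D)%N -> (u + v + w = p)%N ->
  (2 * m * v <= 2 * m * D + D * h + (m + D) * p)%N ->
  (2 * m * w <= 2 * m * D + D * h + (m + D) * p)%N -> (h * 2 <= p)%N ->
  (m * `|v%:Z - w%:Z| <= 2 * D * p)%N.
Proof.
rewrite expnS expn1 => m0 mp uD uvw bv bw hp.
have m2 : (m <= m * m)%N by rewrite leq_pmull.
have e1 : (m * (u + v + w) = m * p)%N by rewrite uvw.
have e2 : (m * u <= m * D)%N by rewrite leq_mul2l uD orbT.
have e3 : (D * (6 * m) <= D * p)%N by rewrite leq_mul2l; lia.
have e4 : (D * (h * 2) <= D * p)%N by rewrite leq_mul2l hp orbT.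
have -> : `|v%:Z - w%:Z|%N = ((v - w) + (w - v))%N by lia.
rewrite mulnDr !mulnBr; lia.
Qed.

Section QuadraticCharacter.
Variables (p : nat) (p_pr : prime p) (p_odd : odd p).
Implicit Types x y z : 'F_p.

Lemma euler_power z : z != 0 ->
  z ^+ ((p - 1) %/ 2) = 1 \/ z ^+ ((p - 1) %/ 2) = -1.
Proof.
move=> z0; have : (z ^+ ((p - 1) %/ 2)) ^+ 2 = 1.
  rewrite -exprM; apply: (mulfI z0); rewrite -exprS mulr1.
  have -> : ((p - 1) %/ 2 * 2).+1 = p.
    by have := prime_gt1 p_pr; move: (divn_eq (p - 1) 2); lia.
  by have := expf_card z; rewrite card_Fp.
by move/eqP; rewrite sqrf_eq1 => /orP[]/eqP; [left|right].
Qed.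

Lemma oner_neqN1 : (1 : 'F_p) != -1.
Proof.
rewrite -subr_eq0 opprK -[1 + 1]/(2%:R) -(dvdn_pcharf (pchar_Fp p_pr)).
rewrite dvdn_prime2//; apply: contraTneq p_odd => ->//.
Qed.

Lemma qchar0 : qchar (0 : 'F_p) = 0. Proof. by rewrite /qchar eqxx. Qed.

Lemma qchar1 : qchar (1 : 'F_p) = 1.
Proof. by rewrite /qchar oner_eq0 expr1n eqxx. Qed.

Lemma qcharM x y : qchar (x * y) = qchar x * qchar y.
Proof.
rewrite /qchar mulf_eq0; have [_|x0] := eqVneq x 0; first by rewrite mul0r.
have [_|y0] /= := eqVneq y 0; first by rewrite mulr0.
have N1 := oner_neqN1; rewrite eq_sym in N1.
rewrite exprMn; have [->|->] := euler_power x0; have [->|->] := euler_power y0;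
  by rewrite ?mulN1r ?mulr1 ?mul1r ?opprK ?eqxx ?(negbTE N1).
Qed.

Lemma qchar_euler x (eps : int) : (eps == 1) || (eps == -1) -> qchar x = eps ->
  x ^+ ((p - 1) %/ 2) = eps%:~R.
Proof.
move=> e1; rewrite /qchar; case: eqVneq => [_ e|x0]; first by move: e1; rewrite -e.
case: (euler_power x0) => ->; first by rewrite eqxx => <-.
by rewrite eq_sym (negbTE oner_neqN1) => <-; rewrite mulrN1z.
Qed.

Lemma qchar_val x : [|| qchar x == 0, qchar x == 1 | qchar x == -1].
Proof. by rewrite /qchar; case: (x == 0) => //; case: (x ^+ _ == 1). Qed.

Lemma qchar_norm x : `|qchar x| <= 1.
Proof. by case/or3P: (qchar_val x) => /eqP ->. Qed.

Lemma qchar_eq0 x : (qchar x == 0) = (x == 0).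
Proof. by rewrite /qchar; case: (x == 0) => //; case: (x ^+ _ == 1). Qed.

(** Otherwise X^((p-1)/2) - 1 would have p - 1 roots. *)
Lemma exists_qchar_N1 : exists x, qchar x = -1.
Proof.
have [E|] := boolP [forall x : 'F_p, (x == 0) || (x ^+ ((p - 1) %/ 2) == 1)]; last first.
  rewrite negb_forall => /existsP[x]; rewrite negb_or => /andP[x0 x1].
  by exists x; rewrite /qchar (negbTE x0) (negbTE x1).
have p3 := odd_prime_gt2 p_odd p_pr.
pose P : {poly 'F_p} := 'X^((p - 1) %/ 2) - 1.
have sP : size P = ((p - 1) %/ 2).+1 by rewrite size_XnsubC//; lia.
have P0 : P != 0 by rewrite -size_poly_gt0 sP.
have := max_poly_roots P0 (rs := [seq x <- enum 'F_p | x != 0]).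
rewrite filter_uniq ?enum_uniq// => H.
have : all (root P) [seq x <- enum 'F_p | x != 0].
  apply/allP => x; rewrite mem_filter => /andP[x0 _].
  move/forallP/(_ x): E; rewrite (negbTE x0) /= => /eqP E.
  by rewrite /root !hornerE E subrr.
move/H => /(_ isT); rewrite sP size_filter.
have := count_predC (pred1 (0 : 'F_p)) (enum 'F_p).
rewrite count_uniq_mem ?enum_uniq// mem_enum -cardE card_Fp// => E2 E3.
have E4 : (1 + count (fun x : 'F_p => x != 0%R) (enum 'F_p) = p)%N := E2.
have H2 k : (2 < p -> 1 + k = p -> k < ((p - 1) %/ 2).+1 -> False)%N by clear; lia.
by case: (H2 _ p3 E4 E3).
Qed.

Lemma sum_qchar : \sum_(x : 'F_p) qchar x = 0.
Proof.
have [c cN1] := exists_qchar_N1.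
have c0 : c != 0 by rewrite -qchar_eq0 cN1.
have : \sum_(x : 'F_p) qchar x = - \sum_(x : 'F_p) qchar x; last lia.
rewrite [LHS](reindex_inj (mulfI c0)) -sumrN; apply: eq_bigr => x _.
by rewrite qcharM cN1 mulN1r.
Qed.

(** Both level sets of the character have at most about p / 2 elements by Stepanov's
    method, and together they fill F_p up to the D = size L + 1 roots.  With m of
    order sqrt p this is Weil's bound up to a constant factor. *)
Lemma sum_qchar_prod (m : nat) (a : 'F_p) (L : seq 'F_p) :
  (0 < m)%N -> (9 * m ^ 2 + (size L).+1 + 1 < p)%N -> a \notin L ->
  (m * `|(\sum_(z : 'F_p) \prod_(b <- a :: L) qchar (z + b))%R| <= 2 * (size L).+1 * p)%N.
Proof.
move=> m0 mp aL; set D := (size L).+1.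
(* Translate so that no factor vanishes at 0. *)
have [c cP] : exists c : 'F_p, c \notin [seq - b | b <- a :: L].
  apply/existsP; apply: contraT; rewrite negb_exists => /forallP H.
  have : (#|'F_p| <= size [seq - b | b <- a :: L])%N.
    rewrite cardE; apply: uniq_leq_size; first exact: enum_uniq.
    by move=> x _; have := H x; rewrite negbK.
  rewrite card_Fp// size_map /=; move: mp; rewrite -/D; lia.
rewrite (reindex_inj (addIr c)).
under eq_bigr do under eq_bigr do rewrite -addrA.
have cb b : b \in a :: L -> c + b != 0.
  by move=> bL; apply: contraNneq cP => /eqP; rewrite addr_eq0 => /eqP ->; apply: map_f.
pose f1 : {poly 'F_p} := \prod_(b <- L) ('X - (- (c + b))%:P).
pose f : {poly 'F_p} := ('X - (- (c + a))%:P) * f1.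
have fE z : f.[z] = \prod_(b <- a :: L) (z + (c + b)).
  rewrite big_cons /f hornerM hornerXsubC opprK; congr (_ * _).
  by rewrite /f1 horner_prod; apply: eq_bigr => b _; rewrite hornerXsubC opprK.
have f1a : ~~ root f1 (- (c + a)).
  rewrite /f1 (big_morph (fun P => ~~ root P (- (c + a)))
    (id1 := true) (op1 := andb) (id2 := 1) (op2 := *%R)).
  - rewrite big_all; apply/allP => b bL; rewrite root_XsubC eqr_opp.
    by apply: contraNneq aL => /addrI ->.
  - by move=> P Q; rewrite rootM negb_or.
  - by rewrite root1.
have c0 : f.[0] != 0.
  rewrite fE prodf_seq_neq0; apply/allP => b bL /=; rewrite add0r; exact: cb.
have [h fp] : exists h, f ^+ p = f.[0]%:P + 'X^p * h.
  have -> : f ^+ p = f \Po 'X^p.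
    have pP : p \in [pchar {poly 'F_p}] by rewrite pchar_poly pchar_Fp.
    have XaE (b : 'F_p) : ('X - b%:P) ^+ p = ('X - b%:P) \Po 'X^p.
      rewrite comp_polyB comp_polyX comp_polyC -!(pFrobenius_autE pP).
      rewrite pFrobenius_autB_comm ?(mulrC b%:P)//; last exact: mulrC.
      rewrite !pFrobenius_autE -polyC_exp; congr (_ - _%:P).
      by have := expf_card b; rewrite card_Fp.
    rewrite /f comp_polyM exprMn XaE; congr (_ * _).
    rewrite /f1 -prodrXl (big_morph _ (id1 := 1) (op1 := *%R)
      (fun P Q => comp_polyM P Q 'X^p) (comp_polyC _ _)).
    by apply: eq_bigr => b _; rewrite XaE.
  have /factor_theorem[q qE] : root (f - f.[0]%:P) 0 by rewrite /root !hornerE subrr.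
  exists (q \Po 'X^p).
  have -> : f \Po 'X^p = f.[0]%:P + ((f - f.[0]%:P) \Po 'X^p).
    by rewrite comp_polyB comp_polyC addrC subrK.
  by rewrite qE comp_polyM subr0 comp_polyX mulrC.
have sf1 : size f1 = D by rewrite size_prod_XsubC.
pose S e := [seq z <- enum 'F_p | qchar f.[z] == e].
have bnd (e : int) : (e == 1) || (e == -1) ->
    (2 * m * size (S e) <= 2 * m * D + D * ((p - 1) %/ 2) + (m + D) * p)%N.
  move=> e1; have := @stepanov_bound p p_pr p_odd _ f1 h f.[0] (e%:~R) f1a c0 fp m m0.
  rewrite sf1; apply=> //; first by rewrite filter_uniq ?enum_uniq.
  by move=> z; rewrite mem_filter => /andP[/eqP zS _]; apply: qchar_euler.
have b1 := bnd 1 isT; have b2 := bnd (-1) isT.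
have S0 : (size (S 0) <= D)%N.
  have : (size (S 0) < size f)%N.
    apply: max_poly_roots; last by rewrite filter_uniq ?enum_uniq.
      by apply: contra_neq c0 => ->; rewrite horner0.
    by apply/allP => z; rewrite mem_filter qchar_eq0 => /andP[].
  by rewrite size_monicM ?monicXsubC// ?size_XsubC ?sf1// -size_poly_gt0 sf1.
have sizeS e : size (S e) = (\sum_(z : 'F_p) (qchar f.[z] == e))%N.
  by rewrite size_filter -sum1_count big_mkcond big_enum; apply: eq_bigr => z _; case: eqP.
have Sp : (size (S 0%R) + size (S 1%R) + size (S (-1)%R) = p)%N.
  rewrite -[RHS](card_Fp p_pr) -sum1_card !sizeS -!big_split /=.
  by apply: eq_bigr => z _; case/or3P: (qchar_val f.[z]) => /eqP ->.
have -> : \sum_(z : 'F_p) \prod_(b <- a :: L) qchar (z + (c + b)) =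
    (size (S 1))%:Z - (size (S (-1)))%:Z.
  rewrite !sizeS !(big_morph Posz PoszD (erefl _)) -sumrB; apply: eq_bigr => z _.
  rewrite -(big_morph _ qcharM qchar1) -fE.
  by case/or3P: (qchar_val f.[z]) => /eqP ->.
have hp : ((p - 1) %/ 2 * 2 <= p)%N by apply: leq_trans (leq_divM _ _) (leq_subr _ _).
exact: (level_set_gap m0 mp S0 Sp b1 b2 hp).
Qed.

End QuadraticCharacter.

(** * Periodic functions *)

Section Periodic.
Variable R : realFieldType.
Implicit Types (f g : nat -> R) (d s : nat).

Definition periodic d f := forall n, f (n + d)%N = f n.
Definition bounded1 f := forall n, `|f n| <= 1.

Lemma periodicMn d f k n : periodic d f -> f (n + k * d)%N = f n.
Proof. by move=> fd; elim: k => [|k IH]; rewrite ?addn0// mulSnr addnA fd. Qed.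

Lemma periodic_dvd d e f : (d %| e)%N -> periodic d f -> periodic e f.
Proof. by move=> /dvdnP[k ->] fd n; rewrite periodicMn. Qed.

Lemma periodic_mod d f n : periodic d f -> f (n %% d)%N = f n.
Proof. by move=> fd; rewrite [in RHS](divn_eq n d) addnC periodicMn. Qed.

Lemma periodicM d f g : periodic d f -> periodic d g ->
  periodic d (fun n => f n * g n).
Proof. by move=> fd gd n; rewrite fd gd. Qed.

Lemma periodic_shift d f k : periodic d f -> periodic d (fun n => f (n + k)%N).
Proof. by move=> fd n; rewrite addnAC fd. Qed.

Lemma bounded1M f g : bounded1 f -> bounded1 g -> bounded1 (fun n => f n * g n).
Proof. by move=> f1 g1 n; rewrite normrM mulr_ile1. Qed.

Lemma bounded1_shift f k : bounded1 f -> bounded1 (fun n => f (n + k)%N).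
Proof. by move=> f1 n; apply: f1. Qed.

Lemma norm_sum_le1 f (a b : nat) : bounded1 f ->
  `|\sum_(a <= n < b) f n| <= (b - a)%:R.
Proof.
move=> f1; apply: le_trans (ler_norm_sum _ _ _) _.
apply: le_trans (ler_sum _ (fun n _ => f1 n)) _.
by rewrite big_const_nat iter_addr addr0.
Qed.

Lemma sum_shift f a b k :
  \sum_(a <= n < b) f (n + k)%N = \sum_(a + k <= n < b + k) f n.
Proof.
rewrite -[(a + k)%N]add0n addnA big_addn.
by rewrite addnK add0n.
Qed.

(** i |-> a + u i permutes the residues modulo d. *)
Lemma sum_affine d f (a u : nat) : periodic d f -> coprime u d ->
  \sum_(i < d) f (a + u * i)%N = \sum_(i < d) f i.
Proof.
case: d => [|d] fd ud; first by rewrite !big_ord0.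
pose h (i : 'I_d.+1) : 'I_d.+1 := inord ((a + u * i) %% d.+1).
have hE i : h i = ((a + u * i) %% d.+1)%N :> nat by rewrite inordK// ltn_pmod.
have h_inj : injective h.
  move=> i j /(congr1 val); rewrite /= !hE => /eqP; rewrite eqn_modDl => E.
  apply/val_inj/eqP => /=; move: E.
  wlog ij : i j / (i <= j)%N.
    move=> W; case/orP: (leq_total i j) => [/W//|/W H E].
    by rewrite eq_sym; apply: H; rewrite eq_sym.
  rewrite eq_sym eqn_mod_dvd ?leq_mul2l ?ij ?orbT// -mulnBr Gauss_dvdr; last by rewrite coprime_sym.
  have := ltn_ord j; case: (posnP (j - i)) => [|p0]; first by lia.
  by move=> jd /(dvdn_leq p0); lia.
rewrite [RHS](reindex_inj h_inj); apply: eq_bigr => i _.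
by rewrite hE periodic_mod.
Qed.

Lemma sum_period d f a : periodic d f ->
  \sum_(a <= n < a + d) f n = \sum_(i < d) f i.
Proof.
move=> fd; rewrite -[in LHS](add0n a) (addnC _ d) -sum_shift big_mkord.
rewrite -(sum_affine a fd (coprime1n d)).
by apply: eq_bigr => i _; rewrite mul1n addnC.
Qed.

Lemma sum_blocks f d e :
  \sum_(i < d * e) f i = \sum_(i < d) \sum_(j < e) f (i + d * j)%N.
Proof.
rewrite exchange_big /=; elim: e => [|e IH]; first by rewrite muln0 !big_ord0.
rewrite big_ord_recr -IH /= mulnSr -!(big_mkord predT (fun i => f i)) /=.
rewrite (big_cat_nat (n := d * e)) ?leq_addr//=; congr (_ + _).
by rewrite -{1}(add0n (d * e)%N) (addnC (d * e)%N d) -sum_shift big_mkord.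
Qed.

(** Sort the residues modulo d * e by their class i modulo d; each class i + d j runs
    through all residues modulo e. *)
Lemma sum_crt d e f g : coprime d e -> periodic d f -> periodic e g ->
  \sum_(i < d * e) f i * g i = (\sum_(i < d) f i) * (\sum_(j < e) g j).
Proof.
move=> de fd ge; rewrite (sum_blocks (fun i => f i * g i)) mulr_suml.
apply: eq_bigr => i _; rewrite -(sum_affine i ge de) mulr_sumr.
by apply: eq_bigr => j _; rewrite mulnC periodicMn.
Qed.

Definition mean d f : R := (\sum_(i < d) f i) / d%:R.

Lemma mean_norm d f : bounded1 f -> `|mean d f| <= 1.
Proof.
move=> f1; rewrite /mean -(big_mkord predT (fun i => f i)) normrM normfV normr_nat.
have [->|d0] := posnP d; first by rewrite invr0 mulr0.
by rewrite ler_pdivrMr ?ltr0n// mul1r; have := norm_sum_le1 0 d f1; rewrite subn0.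
Qed.

Lemma sum_interval d f a N : (0 < d)%N -> periodic d f -> bounded1 f ->
  `|\sum_(a <= n < a + N) f n - N%:R * mean d f| <= 2 * d%:R.
Proof.
move=> d0 fd f1.
have d0R : d%:R != 0 :> R by rewrite pnatr_eq0 -lt0n.
have blocks k : \sum_(a <= n < a + k * d) f n = k%:R * \sum_(i < d) f i.
  elim: k => [|k IH]; first by rewrite mul0n addn0 big_geq// mul0r.
  rewrite (big_cat_nat (n := (a + k * d)%N)) ?leq_addr ?leq_add2l ?leq_mul//=.
  by rewrite IH mulSnr addnA sum_period// -natr1 mulrDl mul1r.
rewrite (big_cat_nat (n := (a + (N %/ d) * d)%N)) ?leq_addr ?leq_add2l ?leq_divM//=.
have NE : N%:R = (N %/ d)%:R * d%:R + (N %% d)%:R :> R.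
  by rewrite -natrM -natrD -divn_eq.
have mE : d%:R * mean d f = \sum_(i < d) f i by rewrite /mean mulrC divfK.
rewrite blocks NE mulrDl -mulrA mE opprD addrACA subrr add0r.
apply: le_trans (ler_normB _ _) _; rewrite [leRHS]mulr_natl mulr2n; apply: lerD.
  apply: le_trans (norm_sum_le1 _ _ f1) _; rewrite ler_nat.
  by rewrite subnDl [X in (X - _)%N](divn_eq N d) addKn ltnW ?ltn_pmod.
rewrite normrM normr_nat; apply: le_trans (ler_piMr _ (mean_norm d f1)) _ => //.
by rewrite ler_nat ltnW ?ltn_pmod.
Qed.

(** * Cube means and Weyl differencing *)

(** The average, over independent pairs h_i, h_i' modulo s, of the absolute value of
    the complete mean modulo s of a product of 2^k translates of f, by the sums that
    take one of r_i h_i and r_i h_i' for each i.  These are the vertices of a cube, as in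
    a Gowers norm. *)
Fixpoint cube_mean s (rs : seq nat) f : R :=
  if rs is r :: rs' then
    (\sum_(h < s) \sum_(h' < s)
       cube_mean s rs' (fun n => f (n + r * h)%N * f (n + r * h')%N)) / s%:R ^+ 2
  else `|mean s f|.

Lemma eq_cube_mean s rs f g : f =1 g -> cube_mean s rs f = cube_mean s rs g.
Proof.
elim: rs f g => [|r rs IH] f g fg /=.
  by rewrite /mean; congr (`|_ / _|); apply: eq_bigr => i _; apply: fg.
congr (_ / _); apply: eq_bigr => h _; apply: eq_bigr => h' _.
by apply: IH => n; rewrite !fg.
Qed.

Lemma cube_mean_ge0 s rs f : 0 <= cube_mean s rs f.
Proof.
elim: rs f => [|r rs IH] f /=; first exact: normr_ge0.
by rewrite mulr_ge0 ?invr_ge0 ?exprn_ge0// sumr_ge0// => h _; rewrite sumr_ge0.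
Qed.

Lemma cube_mean_le1 s rs f : bounded1 f -> cube_mean s rs f <= 1.
Proof.
elim: rs f => [|r rs IH] f f1 /=; first exact: mean_norm.
have [->|s0] := posnP s; first by rewrite expr0n invr0 mulr0.
rewrite ler_pdivrMr ?exprn_gt0 ?ltr0n// mul1r.
have H (h h' : 'I_s) : cube_mean s rs (fun n => f (n + r * h)%N * f (n + r * h')%N) <= 1.
  by apply: IH; apply: bounded1M; apply: bounded1_shift.
apply: le_trans (ler_sum _ (fun h _ => ler_sum _ (fun h' _ => H h h'))) _.
by rewrite !sumr_const !card_ord -mulrnA mulnn natrX.
Qed.

(** A uniform shift h modulo s * t is an independent pair of uniform shifts modulo s
    and modulo t. *)
Lemma cube_mean_crt s t rs f g : coprime s t -> periodic s f -> periodic t g ->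
  cube_mean (s * t) rs (fun n => f n * g n) = cube_mean s rs f * cube_mean t rs g.
Proof.
move=> st; elim: rs f g => [|r rs IH] f g fs gt /=.
  by rewrite /mean sum_crt// natrM invfM mulrACA normrM.
pose F h h' := cube_mean s rs (fun n => f (n + r * h)%N * f (n + r * h')%N).
pose G h h' := cube_mean t rs (fun n => g (n + r * h)%N * g (n + r * h')%N).
have sh d (u : nat -> R) k n : periodic d u -> u (n + r * (k + d))%N = u (n + r * k)%N.
  by move=> ud; rewrite mulnDr addnA periodicMn.
have Fs h : periodic s (F h).
  by move=> h'; apply: eq_cube_mean => n; congr (_ * _); apply: sh.
have Fs' h' : periodic s (F^~ h').
  by move=> h; apply: eq_cube_mean => n; congr (_ * _); apply: sh.
have Gt h : periodic t (G h).
  by move=> h'; apply: eq_cube_mean => n; congr (_ * _); apply: sh.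
have Gt' h' : periodic t (G^~ h').
  by move=> h; apply: eq_cube_mean => n; congr (_ * _); apply: sh.
rewrite natrM exprMn invfM mulrACA; congr (_ * _).
under eq_bigr => h _.
  under eq_bigr => h' _.
    rewrite (eq_cube_mean _ _ (g := fun n => (f (n + r * h)%N * f (n + r * h')%N) *
      (g (n + r * h)%N * g (n + r * h')%N))); last by move=> n; rewrite mulrACA.
    rewrite IH; [|by apply: periodicM; apply: periodic_shift
                 |by apply: periodicM; apply: periodic_shift].
    rewrite -/(F h h') -/(G h h'); over.
  rewrite (sum_crt st (Fs h) (Gt h)); over.
rewrite (sum_crt (f := fun h => \sum_(i < s) F h i) (g := fun h => \sum_(i < t) G h i))//.
  by move=> h; apply: eq_bigr => i _; apply: Fs'.
by move=> h; apply: eq_bigr => i _; apply: Gt'.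
Qed.

(** The factors are left unnamed, so that the property passes from f to the products
    f(n + u) f(n + v) which differencing creates. *)
Fixpoint periodic_product (rs : seq nat) f : Prop :=
  if rs is r :: rs' then
    exists phi g, [/\ periodic r phi, bounded1 phi, periodic_product rs' g
                    & f =1 (fun n => phi n * g n)]
  else f =1 (fun=> 1).

Lemma periodic_product_bounded rs f : periodic_product rs f -> bounded1 f.
Proof.
elim: rs f => [|r rs IH] f /=; first by move=> fE n; rewrite fE normr1.
move=> [phi [g [_ p1 /IH g1 fE]]] n; rewrite fE; exact: bounded1M.
Qed.

Lemma periodic_product_cube rs f u v : periodic_product rs f ->
  periodic_product rs (fun n => f (n + u)%N * f (n + v)%N).
Proof.
elim: rs f => [|r rs IH] f /=; first by move=> fE n; rewrite !fE mulr1.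
move=> [phi [g [pr p1 /IH gP fE]]].
exists (fun n => phi (n + u)%N * phi (n + v)%N), (fun n => g (n + u)%N * g (n + v)%N).
split=> //; first by apply: periodicM; apply: periodic_shift.
  by apply: bounded1M; apply: bounded1_shift.
by move=> n; rewrite !fE mulrACA.
Qed.

(** Shifting n by the multiples r h, h < s, fixes the factor of period r, and Cauchy's
    inequality removes it at the cost of squaring the rest.  The expected bound is
    the 2^k-th root of the cube mean.  Replacing each square root by a tangent,
    2 |X| <= X^2 / (s w) + s w, gives instead a bound that is linear in the cube mean
    and can be averaged over h and h'; w is the size of saving aimed at, and w^2
    takes its place after one step. *)
Lemma weyl_differencing s rs f psi a N (w : R) :
  (0 < s)%N -> periodic_product rs f -> periodic s psi -> bounded1 psi ->
  0 < w -> w <= 1 ->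
  (forall r, r \in rs -> (2 * r * s)%:R <= N%:R * w ^+ (2 ^ size rs)) ->
  (2 * s)%:R <= N%:R * w ^+ (2 ^ size rs) ->
  `|\sum_(a <= n < a + N) f n * psi n| <=
    N%:R * (3 * w + cube_mean s rs psi * w / w ^+ (2 ^ size rs)).
Proof.
move=> s0; elim: rs f psi w => [|r rs IH] f psi w /=.
  rewrite expn0 expr1 => f1 ps p1 w0 w1 _ sN.
  under eq_bigr do rewrite f1 mul1r.
  rewrite mulfK ?gt_eqF//.
  have := sum_interval a N s0 ps p1; set S := \sum_(_ <= _ < _) _ => H.
  have -> : S = (S - N%:R * mean s psi) + N%:R * mean s psi by rewrite subrK.
  apply: le_trans (ler_normD _ _) _; rewrite mulrDr; apply: lerD.
    apply: le_trans H _; rewrite -natrM; apply: le_trans sN _.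
    by rewrite ler_wpM2l//; lra.
  by rewrite normrM normr_nat.
move=> [phi [g [pr p1 gP fE]]] ps psi1 w0 w1 rN sN.
set K := (2 ^ size rs)%N.
have KE : w ^+ (2 ^ (size rs).+1) = (w ^+ 2) ^+ K by rewrite -exprM -expnS.
rewrite KE in rN sN *.
pose G n := g n * psi n.
have g1 := periodic_product_bounded gP.
have G1 : bounded1 G by apply: bounded1M.
under eq_bigr do rewrite fE -mulrA -/(G _).
set S := \sum_(_ <= _ < _) _.
pose X n := \sum_(h < s) G (n + r * h)%N.
have w20 : 0 < w ^+ 2 by rewrite exprn_gt0.
have w21 : w ^+ 2 <= 1 by rewrite exprn_ile1// ltW.
have s0R : 0 < s%:R :> R by rewrite ltr0n.
have wK : (w ^+ 2) ^+ K <= w.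
  rewrite -exprM -[leRHS]expr1; apply: ler_wiXn2l => //; first exact: ltW.
  by rewrite /K; have := expn_gt0 2 (size rs); lia.
(* Replacing n by n + r h moves r h terms at each end of the interval. *)
have shiftS (h : 'I_s) :
    `|S - \sum_(a <= n < a + N) phi n * G (n + r * h)%N| <= (2 * r * s)%:R.
  under [X in _ - X]eq_bigr => n _ do rewrite -(periodicMn h n pr) (mulnC h).
  rewrite (sum_shift (fun n => phi n * G n)).
  set b := (r * h)%N; have F1 : bounded1 (fun n => phi n * G n) by apply: bounded1M.
  have e1 := big_cat_nat (F := fun n => phi n * G n) (op := +%R) (idx := 0)
    (m := a) (n := a + N) (p := a + N + b) (P := predT) (leq_addr _ _) (leq_addr _ _).
  have e2 := big_cat_nat (F := fun n => phi n * G n) (op := +%R) (idx := 0)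
    (m := a) (n := a + b) (p := a + N + b) (P := predT) (leq_addr _ _)
    (leq_add (leq_addr _ _) (leqnn b)).
  have n1 := norm_sum_le1 (a + N) (a + N + b) F1.
  have n2 := norm_sum_le1 a (a + b) F1.
  rewrite addKn in n1; rewrite addKn in n2.
  have -> : S - \sum_(a + b <= n < a + N + b) phi n * G n =
     \sum_(a <= n < a + b) phi n * G n - \sum_(a + N <= n < a + N + b) phi n * G n.
    by apply/eqP; rewrite subr_eq addrAC -e2 e1 addrK.
  apply: le_trans (ler_normB _ _) _; apply: le_trans (lerD n2 n1) _.
  rewrite -natrD ler_nat /b -mulnA mul2n -addnn.
  by apply: leq_add; rewrite leq_mul2l (ltnW (ltn_ord h)) orbT.
have step1 : s%:R * `|S| <= \sum_(a <= n < a + N) `|X n| + s%:R * (2 * r * s)%:R.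
  have -> : s%:R * `|S| = `|\sum_(h < s) S|.
    by rewrite sumr_const card_ord normrMn mulr_natl.
  have -> : \sum_(h < s) S = \sum_(h < s) \sum_(a <= n < a + N) phi n * G (n + r * h)%N
     + \sum_(h < s) (S - \sum_(a <= n < a + N) phi n * G (n + r * h)%N).
    by rewrite -big_split; apply: eq_bigr => h _ /=; rewrite addrC subrK.
  apply: le_trans (ler_normD _ _) _; apply: lerD.
    rewrite exchange_big /=; apply: le_trans (ler_norm_sum _ _ _) _.
    apply: ler_sum => n _; rewrite -mulr_sumr normrM -[leRHS]mul1r.
    by apply: ler_wpM2r.
  apply: le_trans (ler_norm_sum _ _ _) _.
  apply: le_trans (ler_sum _ (fun h _ => shiftS h)) _.
  by rewrite sumr_const card_ord mulr_natl.
have step2 n : `|X n| <= (X n ^+ 2 / (s%:R * w) + s%:R * w) / 2.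
  have sw : 0 < s%:R * w by rewrite mulr_gt0.
  rewrite ler_pdivlMr// -(ler_pM2r sw) mulrDl divfK ?gt_eqF//.
  rewrite -real_normK ?num_real//.
  have := sqr_ge0 (`|X n| - s%:R * w); nra.
set U := cube_mean s (r :: rs) psi.
(* The induction hypothesis at w^2, for each pair h, h'. *)
have step3 : \sum_(a <= n < a + N) X n ^+ 2 <=
    N%:R * s%:R ^+ 2 * (3 * w ^+ 2 + U * w ^+ 2 / (w ^+ 2) ^+ K).
  have -> : \sum_(a <= n < a + N) X n ^+ 2 =
      \sum_(h < s) \sum_(h' < s) \sum_(a <= n < a + N)
        (g (n + r * h)%N * g (n + r * h')%N) * (psi (n + r * h)%N * psi (n + r * h')%N).
    under eq_bigr => n _.
      rewrite expr2 /X big_distrlr /=; over.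
    rewrite exchange_big /=; apply: eq_bigr => h _.
    rewrite exchange_big /=; apply: eq_bigr => h' _.
    by apply: eq_bigr => n _; rewrite /G mulrACA.
  have IHh (h h' : 'I_s) := le_trans (ler_norm _) (IH _ _ (w ^+ 2) (periodic_product_cube (r * h) (r * h') gP)
    (periodicM (periodic_shift (r * h) ps) (periodic_shift (r * h') ps))
    (bounded1M (bounded1_shift (r * h) psi1) (bounded1_shift (r * h') psi1)) w20 w21
    (fun r' r'rs => rN r' (mem_behead (s := r :: rs) r'rs)) sN).
  apply: le_trans (ler_sum _ (fun h _ => ler_sum _ (fun h' _ => IHh h h'))) _.
  rewrite le_eqVlt; apply/orP; left; apply/eqP.
  have sum2 (A B C : R) (F : 'I_s -> 'I_s -> R) :
      \sum_(h < s) \sum_(h' < s) A * (B + F h h' * C) =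
      A * (s%:R ^+ 2 * B + (\sum_(h < s) \sum_(h' < s) F h h') * C).
    under eq_bigr => h _.
      rewrite -mulr_sumr big_split /= sumr_const card_ord -mulr_suml; over.
    rewrite -mulr_sumr big_split /= sumr_const card_ord -mulr_suml.
    by rewrite -(mulr_natl (B *+ s) s) -(mulr_natl B s) mulrA expr2.
  under eq_bigr => h _ do under eq_bigr => h' _ do rewrite -mulrA.
  rewrite sum2 -mulrA; congr (_ * _); rewrite mulrDr; congr (_ + _).
  rewrite /U /= -/K; set Q := \sum_(_ < _) _.
  by field; rewrite ?expf_neq0 ?gt_eqF.
have step4 : s%:R * `|S| <= N%:R * s%:R *
    ((3 * w + U * w / (w ^+ 2) ^+ K) + w) / 2 + s%:R * (2 * r * s)%:R.
  apply: le_trans step1 _; rewrite lerD2r.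
  apply: le_trans (ler_sum _ (fun n _ => step2 n)) _.
  rewrite -mulr_suml ler_pM2r ?invr_gt0 ?ltr0n// big_split /= -mulr_suml.
  rewrite big_const_nat iter_addr addr0 addKn -(mulr_natl (s%:R * w)) [leRHS]mulrDr.
  apply: lerD; last by rewrite mulrA.
  have sw : 0 < s%:R * w by rewrite mulr_gt0.
  rewrite ler_pdivrMr//; apply: le_trans step3 _.
  rewrite le_eqVlt; apply/orP; left; apply/eqP.
  by field; rewrite ?expf_neq0 ?gt_eqF.
have rN' := rN r (mem_head _ _).
have U0 : 0 <= U * w / (w ^+ 2) ^+ K.
  apply: mulr_ge0; last by rewrite invr_ge0 !exprn_ge0// ltW.
  by apply: mulr_ge0; [exact: cube_mean_ge0|exact: ltW].
have H1 : s%:R * (2 * r * s)%:R <= s%:R * (N%:R * w) :> R.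
  by rewrite ler_pM2l//; apply: le_trans rN' _; rewrite ler_wpM2l.
set V := U * w / _ in step4 U0.
have H2 : 0 <= N%:R * s%:R * V :> R by rewrite mulr_ge0// mulr_ge0.
have : s%:R * `|S| <= s%:R * (N%:R * (3 * w + V)).
  apply: le_trans step4 _.
  have -> : N%:R * s%:R * (3 * w + V + w) / 2 + s%:R * (2 * r * s)%:R =
    2 * (s%:R * (N%:R * w)) + (N%:R * s%:R * V) / 2 + s%:R * (2 * r * s)%:R by field.
  have -> : s%:R * (N%:R * (3 * w + V)) = 3 * (s%:R * (N%:R * w)) + N%:R * s%:R * V by ring.
  by lra.
by rewrite (ler_pM2l s0R).
Qed.

End Periodic.

(** * Cube means of Legendre symbols *)

Section LocalCubeMean.
Variables (R : realFieldType) (p : nat) (p_pr : prime p) (p_odd : odd p).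

Definition qchar_nat (n : nat) : R := (qchar (n%:R : 'F_p))%:~R.

Definition qchar_shifts (L : seq 'F_p) (n : nat) : R :=
  (\prod_(b <- L) qchar ((n%:R : 'F_p) + b))%:~R.

Lemma qchar_shifts_bounded L : bounded1 (qchar_shifts L).
Proof.
move=> n; rewrite /qchar_shifts -intr_norm -[leRHS]/(1%:~R) ler_int normr_prod.
elim: L => [|b L IH]; first by rewrite big_nil.
by rewrite big_cons mulr_ile1 ?prodr_ge0 ?qchar_norm.
Qed.

Lemma natr_Fp_inj : injective (fun n : 'I_p => (n : nat)%:R : 'F_p).
Proof.
by move=> i j /(congr1 val); rewrite /= !val_Fp_nat// !modn_small// => /val_inj.
Qed.

Lemma sum_ord_Fp (F : 'F_p -> int) :
  \sum_(n < p) F (n : nat)%:R = \sum_(z : 'F_p) F z.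
Proof.
rewrite (reindex (fun n : 'I_p => (n : nat)%:R : 'F_p))//.
by apply: onW_bij; apply: inj_card_bij; [exact: natr_Fp_inj|rewrite card_Fp// card_ord].
Qed.

(** For each b there is at most one h modulo p with c = b + r h. *)
Lemma count_coincidences (r c : 'F_p) (L : seq 'F_p) : r != 0 ->
  (\sum_(h < p) (c \in [seq (b + r * (h : nat)%:R)%R | b <- L]) <= size L)%N.
Proof.
move=> r0; elim: L => [|b L IH] /=; first by rewrite big1.
apply: (@leq_trans (\sum_(h < p) ((c == b + r * (h : nat)%:R)%R +
    (c \in [seq (b + r * (h : nat)%:R)%R | b <- L])))%N).
  by apply: leq_sum => h _; rewrite inE; case: eqP => //=; case: (_ \in _).
rewrite big_split; apply: (leq_add (n1 := 1) _ IH) => /=.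
have -> : (\sum_(h < p) (c == b + r * (h : nat)%:R)%R =
    \sum_(h < p | ((h : nat)%:R : 'F_p) == ((c - b) / r)%R) 1)%N.
  rewrite [RHS]big_mkcond; apply: eq_bigr => h _.
  rewrite (addrC b) -subr_eq; set y := (c - b)%R.
  suff -> : (y == r * (h : nat)%:R)%R = ((h : nat)%:R == (y / r)%R :> 'F_p) by case: eqP.
  by apply/eqP/eqP => [->|->]; [rewrite mulrAC divff ?mul1r|rewrite mulrCA divff ?mulr1].
rewrite sum1_card; apply/card_le1P => h; rewrite unfold_in => /eqP hE h'.
by rewrite [LHS]unfold_in -hE [RHS]inE; exact: (inj_eq natr_Fp_inj).
Qed.

(** Weil's bound fails only if the vertex coming from the head of the list meets
    another vertex.  A differencing step doubles the list, and creates such a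
    coincidence for at most size L + 1 of the p values of h' for each h; summed over the
    steps, this gives the factor 2^k - 1. *)
Lemma cube_mean_qchar_shifts (m : nat) (rs : seq nat) (a : 'F_p) (L : seq 'F_p) :
  (0 < m)%N -> (9 * m ^ 2 + 2 ^ size rs * (size L).+1 + 1 < p)%N ->
  all (coprime p) rs ->
  cube_mean p rs (qchar_shifts (a :: L)) <=
    (a \in L)%:R + ((2 ^ size rs - 1) * (size L).+1)%:R / p%:R
    + (2 * (2 ^ size rs * (size L).+1))%:R / m%:R.
Proof.
move=> m0; elim: rs a L => [|r rs IH] a L.
  move=> mp _; rewrite expn0 mul1n subnn mul0n mul0r addr0.
  have [aL|aL] := boolP (a \in L).
    apply: le_trans (cube_mean_le1 _ _ (qchar_shifts_bounded _)) _.
    by rewrite lerDl mulr_ge0// invr_ge0.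
  rewrite add0r /= /mean /qchar_shifts -(big_morph intr (rmorphD _) (rmorph0 _)).
  rewrite (sum_ord_Fp (fun z => \prod_(b <- a :: L) qchar (z + b))).
  set S := \sum_(z : _) _; rewrite normrM normfV normr_nat.
  rewrite ler_pdivrMr ?ltr0n ?prime_gt0// mulrAC ler_pdivlMr ?ltr0n//.
  rewrite -intr_norm -abszE -[X in X * _]/((absz S)%:R) -!natrM ler_nat.
  have mp' : (9 * m ^ 2 + (size L).+1 + 1 < p)%N by move: mp; rewrite expn0 mul1n.
  by have := sum_qchar_prod p_pr p_odd m0 mp' aL; rewrite -/S mulnC.
move=> mp /= /andP[pr prs].
have [aL|aL] := boolP (a \in L).
  apply: le_trans (cube_mean_le1 p (r :: rs) (qchar_shifts_bounded (a :: L))) _.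
  by rewrite -addrA lerDl addr_ge0// mulr_ge0// invr_ge0.
set k := size rs in IH mp *.
pose sh h := [seq b + r%:R * h%:R | b <- L].
pose Lh (h h' : nat) := sh h ++ (a + r%:R * h'%:R) :: sh h'.
have LhE (h h' : nat) : (fun n => qchar_shifts (a :: L) (n + r * h)%N *
    qchar_shifts (a :: L) (n + r * h')%N) =1 qchar_shifts ((a + r%:R * h%:R) :: Lh h h').
  move=> n; have -> : (a + r%:R * h%:R) :: Lh h h' =
    [seq b + r%:R * h%:R | b <- a :: L] ++ [seq b + r%:R * h'%:R | b <- a :: L] by [].
  rewrite /qchar_shifts -intrM big_cat !big_map.
  by congr (_ * _)%:~R; apply: eq_bigr => b _; rewrite natrD natrM -addrA (addrC b).
have szLh h h' : (size (Lh h h')).+1 = (2 * (size L).+1)%N.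
  by rewrite size_cat /= !size_map -addSn addnn mul2n.
have p0 : 0 < p%:R :> R by rewrite ltr0n prime_gt0.
have bnd (h h' : 'I_p) : cube_mean p rs (fun n => qchar_shifts (a :: L) (n + r * h)%N *
    qchar_shifts (a :: L) (n + r * h')%N) <=
    (a + r%:R * h%:R \in Lh h h')%:R + (((2 ^ k - 1) * (2 * (size L).+1))%:R / p%:R
    + (2 * (2 ^ k.+1 * (size L).+1))%:R / m%:R).
  rewrite (eq_cube_mean _ _ (LhE h h')); apply: le_trans (IH _ _ _ prs) _.
    by rewrite szLh mulnA -expnSr.
  by rewrite szLh -addrA (mulnA (2 ^ k)%N) -expnSr.
rewrite ler_pdivrMr ?exprn_gt0//.
apply: le_trans (ler_sum _ (fun h _ => ler_sum _ (fun h' _ => bnd h h'))) _.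
under eq_bigr do rewrite big_split /= sumr_const card_ord.
rewrite big_split /= sumr_const card_ord -mulrnA.
set C := (2 * (2 ^ k.+1 * (size L).+1))%:R / m%:R.
have r0 : (r%:R : 'F_p) != 0.
  by rewrite -(dvdn_pcharf (pchar_Fp p_pr)) -prime_coprime.
have cnt (h : 'I_p) : \sum_(h' < p) (a + r%:R * h%:R \in Lh h h')%:R <= (size L).+1%:R :> R.
  rewrite -natr_sum ler_nat.
  apply: leq_trans (count_coincidences (a + r%:R * (h : nat)%:R) (a :: L) r0).
  apply: leq_sum => h' _; rewrite /Lh mem_cat (mem_map (addIr _)) (negbTE aL) /=.
  by rewrite inE.
have cnt2 : \sum_(h < p) \sum_(h' < p) (a + r%:R * (h : nat)%:R \in Lh h h')%:R <=
    (size L).+1%:R *+ p :> R.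
  by apply: le_trans (ler_sum _ (fun h _ => cnt h)) _; rewrite sumr_const card_ord.
apply: le_trans (lerD cnt2 (lexx _)) _.
have E : ((size L).+1 + (2 ^ k - 1) * (2 * (size L).+1) = (2 ^ k.+1 - 1) * (size L).+1)%N.
  rewrite expnS !mulnBl !mul1n mulnCA mulnA.
  have : (1 * (size L).+1 <= 2 ^ k * (size L).+1)%N by rewrite leq_mul2r expn_gt0.
  by lia.
rewrite add0r -E natrD -(mulr_natr (size L).+1%:R p) -(mulr_natr (_ + C) (p * p)) natrM.
by rewrite le_eqVlt; apply/orP; left; apply/eqP; field; rewrite gt_eqF.
Qed.

End LocalCubeMean.

(** * Legendre's sieve *)

Section Sieve.
Variable R : realFieldType.
Implicit Types (f : nat -> R) (ps : seq nat).

(** n %/ p + ~~ (p %| n) is n / p rounded up. *)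
Lemma sum_multiples (p : nat) f a b : (0 < p)%N -> (a <= b)%N ->
  \sum_(a <= n < b | (p %| n)%N) f n =
  \sum_((a %/ p + ~~ (p %| a))%N <= m < (b %/ p + ~~ (p %| b))%N) f (p * m)%N.
Proof.
move=> p0 ab; rewrite -(subnKC ab); elim: (b - a)%N => [|N IH].
  by rewrite addn0 !big_geq.
have ceilS n : (n.+1 %/ p + ~~ (p %| n.+1) = n %/ p + ~~ (p %| n) + (p %| n))%N.
  by rewrite divnS// -addnA; case: (dvdn _ _); case: (dvdn _ _); rewrite /=; lia.
have mono : (a %/ p + ~~ (p %| a) <= (a + N) %/ p + ~~ (p %| a + N))%N.
  elim: N {IH} => [|N IH]; rewrite ?addn0// addnS ceilS; lia.
rewrite addnS big_mkcond big_nat_recr ?leq_addr//= -big_mkcond IH ceilS.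
case: (boolP (p %| a + N)%N) => [pn|_]; last by rewrite addr0 !addn0.
rewrite addn1 addn0 big_nat_recr /=; last by move: mono; rewrite pn addn0.
by congr (_ + f _); rewrite mulnC divnK.
Qed.

Lemma prod_oneB_inv_bounds ps : all prime ps ->
  (2^-1 : R) ^+ size ps <= \prod_(p <- ps) (1 - p%:R^-1) <= (1 : R).
Proof.
elim: ps => [|q ps IH] /=; first by rewrite big_nil expr0 lexx.
move=> /andP[/prime_gt1 q1 /IH/andP[l u]]; rewrite big_cons exprS.
have q0 : 0 < q%:R^-1 :> R by rewrite invr_gt0 ltr0n ltnW.
have q2 : q%:R^-1 <= 2^-1 :> R by rewrite lef_pV2 ?posrE ?ltr0n ?ler_nat// ltnW.
have Q0 : 0 <= \prod_(p <- ps) (1 - p%:R^-1) :> R by rewrite (le_trans _ l)// exprn_ge0// invr_ge0.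
have q3 : 0 <= 1 - q%:R^-1 :> R by lra.
have q4 : 1 - q%:R^-1 <= 1 :> R by lra.
apply/andP; split; last exact: mulr_ile1.
by apply: ler_pM; rewrite ?exprn_ge0 ?invr_ge0//; lra.
Qed.

Lemma ceil_div_bounds (p n : nat) : (0 < p)%N ->
  n%:R <= (n %/ p + ~~ (p %| n))%N%:R * p%:R :> R /\
  (n %/ p + ~~ (p %| n))%N%:R * p%:R <= n%:R + p%:R :> R.
Proof.
move=> p0; have nE : n%:R = (n %/ p)%N%:R * p%:R + (n %% p)%N%:R :> R.
  by rewrite -natrM -natrD -divn_eq.
rewrite natrD mulrDl /dvdn; have := ltn_pmod n p0; case: eqP => [n0|/eqP n0] np.
  have : 0 <= p%:R :> R by [].
  by move: nE; rewrite n0 /= mul0r => nE; split; lra.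
have m1 : 1 <= (n %% p)%N%:R :> R by rewrite ler1n lt0n.
have m2 : (n %% p)%N%:R <= p%:R :> R by rewrite ler_nat ltnW.
by rewrite mul1r; split; lra.
Qed.

(** A prime p coprime to the period d permutes the residues modulo d, so that
    n |-> f(p n) has period d and the same mean as f: inclusion-exclusion over the
    primes multiplies the main term by 1 - 1/p and doubles the error.  The term -1
    absorbs the rounding of N / p. *)
Lemma legendre_sieve d f ps a N : (0 < d)%N -> periodic d f -> bounded1 f ->
  uniq ps -> all prime ps -> all (coprime d) ps ->
  `|\sum_(a <= n < a + N) f n * \prod_(p <- ps) (~~ (p %| n)%N)%:R
    - N%:R * (mean d f * \prod_(p <- ps) (1 - p%:R^-1))| <= (2 ^ size ps * (4 * d))%:R - 1.
Proof.
move=> d0; elim: ps f a N => [|p ps IH] f a N fd f1 /=.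
  move=> _ _ _; rewrite expn0 mul1n.
  under eq_bigr do rewrite big_nil mulr1.
  rewrite big_nil mulr1; apply: le_trans (sum_interval a N d0 fd f1) _.
  have : 1 <= d%:R :> R by rewrite ler1n.
  by rewrite natrM; lra.
move=> /andP[pps ups] /andP[pp pr] /andP[dp dps].
have p0 := prime_gt0 pp.
pose G n : R := \prod_(q <- ps) (~~ (q %| n)%N)%:R.
have Gp n : G (p * n)%N = G n.
  rewrite /G !big_seq; apply: eq_bigr => q qps; rewrite Gauss_dvdr//.
  rewrite coprime_sym prime_coprime// dvdn_prime2//; last exact: (allP pr).
  by apply: contraNneq pps => ->.
pose a' := (a %/ p + ~~ (p %| a))%N.
pose b' := ((a + N) %/ p + ~~ (p %| a + N))%N.
have fpd : periodic d (fun n => f (p * n)%N).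
  by move=> n; rewrite mulnDr periodicMn.
have fp1 : bounded1 (fun n => f (p * n)%N) by move=> n; apply: f1.
have meanE : mean d (fun n => f (p * n)%N) = mean d f.
  rewrite /mean -(sum_affine 0 fd (u := p)) 1?coprime_sym//.
have ab' : (a' <= b')%N.
  rewrite /a' /b'; elim: N {b'} => [|n IHn]; first by rewrite addn0.
  apply: leq_trans IHn _; rewrite addnS divnS//.
  by case: (dvdn _ _); case: (dvdn _ _); rewrite /=; lia.
have -> : \sum_(a <= n < a + N) f n * \prod_(q <- p :: ps) (~~ (q %| n)%N)%:R =
   \sum_(a <= n < a + N) f n * G n - \sum_(a' <= m < a' + (b' - a')) f (p * m)%N * G m.
  rewrite subnKC//.
  have -> : \sum_(a' <= m < b') f (p * m)%N * G m = \sum_(a' <= m < b') f (p * m)%N * G (p * m)%N.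
    by apply: eq_bigr => m _; rewrite Gp.
  rewrite -(sum_multiples (fun n => f n * G n) p0 (leq_addr N a)).
  rewrite [X in _ - X]big_mkcond -sumrB; apply: eq_bigr => n _.
  rewrite big_cons -/(G n); case: (p %| n)%N; first by rewrite /= mul0r mulr0 subrr.
  by rewrite mul1r subr0.
have h1 := IH f a N fd f1 ups pr dps.
have h2 := IH _ a' (b' - a')%N fpd fp1 ups pr dps.
rewrite meanE in h2.
rewrite big_cons; set Q := \prod_(q <- ps) (1 - _) in h1 h2 *.
set S1 := \sum_(_ <= n < a + N) _ in h1 *; set S2 := \sum_(_ <= m < _) _ in h2 *.
have Q1 : `|mean d f * Q| <= 1.
  rewrite normrM mulr_ile1 ?mean_norm// /Q.
  have /andP[Q0 Q1] := prod_oneB_inv_bounds pr.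
  by rewrite ger0_norm// (le_trans _ Q0)// exprn_ge0// invr_ge0.
have NN : `|(b' - a')%:R - N%:R / p%:R| <= 1 :> R.
  have p0R : 0 < p%:R :> R by rewrite ltr0n.
  have [] := ceil_div_bounds a p0; have [] := ceil_div_bounds (a + N) p0.
  rewrite -/a' -/b' natrD natrB// => c1 c2 c3 c4.
  rewrite -(ler_pM2r p0R) mul1r -{2}(gtr0_norm p0R) -normrM mulrBl divfK ?gt_eqF//.
  by rewrite ler_norml; apply/andP; split; lra.
have -> : S1 - S2 - N%:R * (mean d f * ((1 - p%:R^-1) * Q)) =
    (S1 - N%:R * (mean d f * Q)) - (S2 - (b' - a')%:R * (mean d f * Q))
    - ((b' - a')%:R - N%:R / p%:R) * (mean d f * Q) by ring.
apply: le_trans (ler_normB _ _) _; apply: le_trans (lerD (ler_normB _ _) (lexx _)) _.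
have : `|((b' - a')%:R - N%:R / p%:R) * (mean d f * Q)| <= 1.
  by rewrite normrM mulr_ile1.
move: h1 h2; rewrite expnS -mulnA (natrM _ 2); lra.
Qed.

End Sieve.

(** * Splitting products into factors of prescribed size *)

Section Grouping.
Variable R : realFieldType.

(** Greedily: a new group is opened only when the current one cannot take the next
    number, so that every closed group has a product of at least Z / X.  This
    bounds the number of groups. *)
Lemma exists_grouping (T : seq nat) (X Z : R) : 0 < X -> X <= Z ->
  (forall q, q \in T -> (0 < q)%N /\ q%:R <= X) ->
  exists TT : seq (seq nat), [/\ flatten TT = T,
    forall g, g \in TT -> (\prod_(q <- g) q)%:R <= Z &
    (Z / X) ^+ (size TT - 1) <= (\prod_(q <- T) q)%:R].
Proof.
move=> X0 XZ TX.
suff [TT [e1 e2 e3]] : exists TT : seq (seq nat), [/\ flatten TT = T,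
    forall g, g \in TT -> (\prod_(q <- g) q)%:R <= Z &
    forall g, g \in behead TT -> Z / X <= (\prod_(q <- g) q)%:R].
  exists TT; split=> //; rewrite -e1 big_flatten.
  have TX' g q : g \in TT -> q \in g -> (0 < q)%N.
    by move=> gT qg; apply: (TX q _).1; rewrite -e1; apply/flattenP; exists g.
  case: TT {e1 e2} e3 TX' => [|g TT] /= e3 TX'; first by rewrite big_nil.
  rewrite subn1 /= big_cons natrM.
  have g1 : 1 <= (\prod_(q <- g) q)%:R :> R.
    rewrite ler1n big_seq prodn_cond_gt0// => q qg; apply: (TX' g) => //.
    exact: mem_head.
  apply: (@le_trans _ _ (\prod_(h <- TT) \prod_(q <- h) q)%:R); last by rewrite ler_peMl.
  elim: TT e3 {TX'} => [|h TT IH] e3; first by rewrite big_nil.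
  rewrite /= exprS big_cons natrM; apply: ler_pM.
  - by rewrite divr_ge0 ?ltW// (lt_le_trans X0).
  - by rewrite exprn_ge0 ?divr_ge0 ?ltW// (lt_le_trans X0).
  - by rewrite e3 ?mem_head.
  - by apply: IH => h' hT; rewrite e3// inE hT orbT.
elim: T TX => [|q T IH] TX; first by exists [::].
have [|TT [e1 e2 e3]] := IH; first by move=> r rT; apply: TX; rewrite inE rT orbT.
have [q0 qX] := TX q (mem_head _ _).
case: TT e1 e2 e3 => [|g TT] /= e1 e2 e3.
  exists [:: [:: q]]; rewrite -e1; split=> // g; rewrite inE => /eqP ->.
  by rewrite big_seq1 (le_trans qX).
have [qgZ|qgZ] := leP ((q * \prod_(r <- g) r)%:R : R) Z.
  exists ((q :: g) :: TT); split; rewrite /= ?e1//.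
  by move=> h; rewrite inE => /orP[/eqP->|hT]; [rewrite big_cons|rewrite e2// inE hT orbT].
exists ([:: q] :: g :: TT); split; rewrite /= ?e1//.
  by move=> h; rewrite inE => /orP[/eqP->|/e2//]; rewrite big_seq1 (le_trans qX).
move=> h; rewrite inE => /orP[/eqP->|/e3//].
rewrite ler_pdivrMr// mulrC; apply: le_trans (ltW qgZ) _.
by rewrite natrM ler_wpM2r.
Qed.

Lemma exists_prefix_prod (T : seq nat) (X Y : R) : 1 <= Y -> 0 < X ->
  (forall q, q \in T -> (0 < q)%N /\ q%:R <= X) -> Y < (\prod_(q <- T) q)%:R ->
  exists T1 T2, [/\ T = T1 ++ T2, (\prod_(q <- T1) q)%:R <= Y &
    Y <= X * (\prod_(q <- T1) q)%:R].
Proof.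
move=> Y1 X0; elim/last_ind: T => [|T q IH] TX.
  by rewrite big_nil => /(le_lt_trans Y1); rewrite ltxx.
rewrite -cats1 big_cat big_seq1 /= => YT.
have TX' r : r \in T -> (0 < r)%N /\ r%:R <= X.
  by move=> rT; apply: TX; rewrite mem_rcons inE rT orbT.
have [TY|YT'] := leP ((\prod_(q <- T) q)%:R : R) Y.
  exists T, [:: q]; split=> //; apply: le_trans (ltW YT) _.
  by rewrite mulnC natrM ler_wpM2r// (TX q _).2// mem_rcons mem_head.
have [T1 [T2 [-> h1 h2]]] := IH TX' YT'.
by exists T1, (T2 ++ [:: q]); rewrite catA.
Qed.

End Grouping.

(** * Sums twisted by Legendre symbols *)

Section CharSums.
Variable R : realFieldType.

Lemma periodic_prod (phi : nat -> nat -> R) (T : seq nat) :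
  (forall q, q \in T -> periodic q (phi q)) ->
  periodic (\prod_(q <- T) q) (fun n => \prod_(q <- T) phi q n).
Proof.
move=> Tp n; rewrite !big_seq; apply: eq_bigr => q qT.
by apply: (periodic_dvd _ (Tp q qT)); rewrite -big_seq (big_rem q qT) dvdn_mulr.
Qed.

Lemma bounded1_prod (phi : nat -> nat -> R) (T : seq nat) :
  (forall q, q \in T -> bounded1 (phi q)) ->
  bounded1 (fun n => \prod_(q <- T) phi q n).
Proof.
by move=> T1 n; rewrite normr_prod big_seq prodr_ile1// => q qT; rewrite normr_ge0 T1.
Qed.

Lemma periodic_product_flatten (phi : nat -> nat -> R) (TT : seq (seq nat)) :
  (forall q, q \in flatten TT -> periodic q (phi q)) ->
  (forall q, q \in flatten TT -> bounded1 (phi q)) ->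
  periodic_product [seq \prod_(q <- g) q | g <- TT]%N
    (fun n => \prod_(q <- flatten TT) phi q n).
Proof.
elim: TT => [|g TT IH] Tp T1 /=; first by move=> n; rewrite big_nil.
have sub1 q : q \in g -> q \in flatten (g :: TT) by rewrite mem_cat => ->.
have sub2 q : q \in flatten TT -> q \in flatten (g :: TT) by rewrite mem_cat orbC => ->.
exists (fun n => \prod_(q <- g) phi q n), (fun n => \prod_(q <- flatten TT) phi q n).
split.
- by apply: periodic_prod => q /sub1; apply: Tp.
- by apply: bounded1_prod => q /sub1; apply: T1.
- by apply: IH => q /sub2; [apply: Tp|apply: T1].
- by move=> n; rewrite big_cat.
Qed.

Lemma qchar_nat_periodic p : prime p -> periodic p (qchar_nat R p).
Proof. by move=> pp n; rewrite /qchar_nat natrD (pcharf0 (pchar_Fp pp)) addr0. Qed.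

Lemma qchar_nat_bounded p : bounded1 (qchar_nat R p).
Proof.
move=> n; rewrite /qchar_nat -intr_norm -[leRHS]/(1%:~R) ler_int; exact: qchar_norm.
Qed.

Lemma qchar_nat_sqr p n : prime p -> qchar_nat R p n ^+ 2 = (~~ (p %| n)%N)%:R.
Proof.
move=> pp; rewrite /qchar_nat (dvdn_pcharf (pchar_Fp pp)) -qchar_eq0.
by case/or3P: (qchar_val (n%:R : 'F_p)) => /eqP ->;
  rewrite ?mulrN1z ?sqrrN ?expr1n ?expr0n.
Qed.

Lemma qchar_nat_sum p : prime p -> odd p -> \sum_(n < p) qchar_nat R p n = 0.
Proof.
move=> pp po; rewrite /qchar_nat -(big_morph intr (rmorphD _) (rmorph0 _)).
by rewrite (sum_ord_Fp pp (@qchar p)) (sum_qchar pp po).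
Qed.

(** The cube mean is at most 3 * 2^k / m with m > sqrt p / 8, which is less than
    p^-1/4 once p exceeds (24 * 2^k)^4.  The fourth power avoids roots, and it makes
    the saving multiplicative over the primes of s. *)
Lemma local_cube_saving p (rs : seq nat) kmax y :
  prime p -> odd p -> (y < p)%N -> (size rs <= kmax)%N ->
  ((24 * 2 ^ kmax) ^ 4 <= y)%N -> all (coprime p) rs ->
  cube_mean p rs (qchar_nat R p) ^+ 4 * p%:R <= 1.
Proof.
move=> pp po yp kk Ky prs; set K := (2 ^ size rs)%N.
have K1 : (0 < K)%N by rewrite expn_gt0.
have V4 : ((24 * K) ^ 4 < p)%N.
  apply: leq_ltn_trans yp; apply: leq_trans Ky.
  by rewrite leq_exp2r// leq_mul2l leq_pexp2l.
have V : (24 * K < p)%N.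
  by apply: leq_ltn_trans V4; rewrite -[X in (X <= _)%N]expn1 leq_pexp2l// muln_gt0 K1.
have [m [m0 mp pm]] : exists m, [/\ (0 < m)%N, (16 * m ^ 2 <= p)%N & (p < 64 * m ^ 2)%N].
  (* m is the integer part of sqrt p / 4. *)
  have ex : exists m, (16 * m ^ 2 <= p)%N by exists 0%N.
  have bd m : (16 * m ^ 2 <= p)%N -> (m <= p)%N.
    by rewrite expnS expn1; case: m => // m; nia.
  case: (ex_maxnP ex bd) => m mp mmax; exists m.
  have m0 : (0 < m)%N.
    by apply: mmax; rewrite exp1n; move: V K1; clear; lia.
  split=> //; rewrite ltnNge; apply/negP => pm.
  have := mmax m.+1; rewrite ltnn => H.
  suff : (16 * m.+1 ^ 2 <= p)%N by move/H.
  apply: leq_trans pm; rewrite !expnS !expn0 !muln1; move: m0; clear; nia.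
have mp' : (9 * m ^ 2 + K * 1 + 1 < p)%N.
  by move: mp V K1; rewrite muln1; move: (m ^ 2)%N => u; clear; lia.
have := @cube_mean_qchar_shifts R p pp po m rs 0 [::] m0 mp' prs.
rewrite in_nil add0r -/K !muln1 => cm.
have {}cm : cube_mean p rs (qchar_nat R p) <= (3 * K)%:R / m%:R.
  have -> : cube_mean p rs (qchar_nat R p) = cube_mean p rs (qchar_shifts R [:: 0 : 'F_p]).
    apply: eq_cube_mean => n.
    by rewrite /qchar_shifts big_cons big_nil mulr1 addr0.
  apply: le_trans cm _.
  have m0R : 0 < m%:R :> R by rewrite ltr0n.
  have p0R : 0 < p%:R :> R by rewrite ltr0n prime_gt0.
  apply: (@le_trans _ _ (K%:R / m%:R + (2 * K)%:R / m%:R)).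
    rewrite lerD2r; apply: ler_pM; rewrite ?invr_ge0 ?ler_nat ?leq_subr//.
    rewrite lef_pV2 ?posrE// ler_nat.
    by move: mp; rewrite expnS expn1; clear -m0; nia.
  by rewrite -mulrDl -natrD; rewrite -{1}(mul1n K) -mulnDl.
have m0R : 0 < m%:R :> R by rewrite ltr0n.
apply: (@le_trans _ _ (((3 * K)%:R / m%:R) ^+ 4 * p%:R)).
  by rewrite ler_wpM2r// lerXn2r// ?nnegrE ?cube_mean_ge0// divr_ge0.
rewrite expr_div_n mulrAC ler_pdivrMr ?exprn_gt0// mul1r -!natrX -natrM ler_nat.
rewrite -(@leq_pmul2l (8 ^ 4))// mulnA -!expnMn mulnA.
apply: (@leq_trans (p ^ 2)).
  by rewrite -[(p ^ 2)%N]mulnn leq_mul2r (ltnW V4) orbT.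
apply: (@leq_trans ((64 * m ^ 2) ^ 2)); first by rewrite leq_exp2r// ltnW.
by rewrite -[64%N]/(8 ^ 2)%N -expnMn -expnM.
Qed.

Lemma coprime_prod (d : nat) (T : seq nat) :
  (forall q, q \in T -> coprime d q) -> coprime d (\prod_(q <- T) q).
Proof.
move=> dT; rewrite big_seq; apply: (big_ind (coprime d)) => //.
  exact: coprimen1.
by move=> u v; rewrite coprimeMr => -> ->.
Qed.

Lemma cube_mean_prod_qchar (T : seq nat) rs :
  uniq T -> all prime T -> 
  (forall p, p \in T -> cube_mean p rs (qchar_nat R p) ^+ 4 * p%:R <= 1) ->
  cube_mean (\prod_(p <- T) p) rs (fun n => \prod_(p <- T) qchar_nat R p n) ^+ 4
    * (\prod_(p <- T) p)%:R <= 1.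
Proof.
elim: T => [|p T IH] /=.
  rewrite !big_nil mulr1 => _ _ _; rewrite exprn_ile1 ?cube_mean_ge0// cube_mean_le1//.
  by move=> n; rewrite big_nil normr1.
move=> /andP[pT uT] /andP[pp prT] Tc.
have TP q : q \in T -> prime q by move/(allP prT).
rewrite !big_cons (eq_cube_mean _ _ (g := fun n => qchar_nat R p n *
  \prod_(q <- T) qchar_nat R q n)); last by move=> n; rewrite big_cons.
have cop : coprime p (\prod_(q <- T) q).
  apply: coprime_prod => q qT; have qp := TP q qT.
  by rewrite prime_coprime// dvdn_prime2//; apply: contraNneq pT => ->.
have pT' : periodic (\prod_(q <- T) q) (fun n => \prod_(q <- T) qchar_nat R q n).
  by apply: periodic_prod => r /TP; apply: qchar_nat_periodic.
rewrite (cube_mean_crt rs cop (qchar_nat_periodic pp) pT').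
rewrite exprMn natrM mulrACA; apply: mulr_ile1.
- by rewrite mulr_ge0// exprn_ge0// cube_mean_ge0.
- by rewrite mulr_ge0// exprn_ge0// cube_mean_ge0.
- by apply: Tc; rewrite mem_head.
- by apply: IH => // q qT; apply: Tc; rewrite inE qT orbT.
Qed.

(** D marks the primes that carry the Legendre symbol; at the others its square is
    the indicator of coprimality.  The modulus 8 stands for the condition on n
    modulo 8, so that all conditions are factors indexed by their moduli. *)
Definition local_factor (D : pred nat) (q n : nat) : R :=
  if q == 8%N then (n %% 8 == 1)%N%:R
  else if D q then qchar_nat R q n else qchar_nat R q n ^+ 2.

Lemma local_factor_periodic D q : (q == 8%N) || prime q -> periodic q (local_factor D q).
Proof.
rewrite /local_factor; case: eqP => [-> _ n|_ /= qp n]; first by rewrite modnDr.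
by case: (D q); rewrite qchar_nat_periodic.
Qed.

Lemma local_factor_bounded D q : bounded1 (local_factor D q).
Proof.
move=> n; rewrite /local_factor; case: eqP => _.
  by case: (_ == _); rewrite ?normr1 ?normr0.
by case: (D q); rewrite ?normrX ?exprn_ile1// qchar_nat_bounded.
Qed.

Lemma local_factor_odd D p n : prime p -> odd p ->
  local_factor D p n = if D p then qchar_nat R p n else qchar_nat R p n ^+ 2.
Proof. by move=> pp po; rewrite /local_factor; case: eqP po => // ->. Qed.

Variables (ps : seq nat) (X : nat).
Hypotheses (ps_uniq : uniq ps) (ps_prime : forall p, p \in ps -> prime p)
  (ps_odd : forall p, p \in ps -> odd p).

Let coprime_ps p q : p \in ps -> q \in 8%N :: ps -> p != q -> coprime p q.
Proof.
move=> pps; have pp := ps_prime pps; rewrite inE => /orP[/eqP-> _|qps pq].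
  by rewrite (@coprimeXr 3 p 2)// coprimen2 ps_odd.
by rewrite prime_coprime// dvdn_prime2 ?ps_prime.
Qed.

Definition twisted_sum (D : pred nat) (a N : nat) : R :=
  \sum_(a <= n < a + N) \prod_(q <- 8%N :: ps) local_factor D q n.

(** The part of the product of period 8 * prod_(D p) p has mean zero, since it
    contains a nontrivial character; the sieve over the primes outside D then leaves
    only the error term. *)
Lemma twisted_sum_small D a N : has D ps ->
  `|twisted_sum D a N| <= (2 ^ size ps * (32 * \prod_(p <- ps | D p) p))%:R.
Proof.
move=> Dps.
set P1 := [seq p <- ps | D p]; set P2 := [seq p <- ps | ~~ D p].
set d := (\prod_(q <- 8%N :: P1) q)%N.
pose f n := \prod_(q <- 8%N :: P1) local_factor D q n.
have inP1 p : p \in P1 -> [/\ D p, p \in ps, prime p & odd p].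
  by rewrite mem_filter => /andP[? pps]; split; rewrite ?ps_prime ?ps_odd.
have inP2 p : p \in P2 -> [/\ ~~ D p, p \in ps, prime p & odd p].
  by rewrite mem_filter => /andP[? pps]; split; rewrite ?ps_prime ?ps_odd.
have d0 : (0 < d)%N.
  rewrite /d big_cons muln_gt0 /= big_seq prodn_cond_gt0// => p /inP1[_ _ /prime_gt0]//.
have fd : periodic d f.
  apply: periodic_prod => q; rewrite inE => /orP[/eqP->|/inP1[_ _ qp _]];
    by apply: local_factor_periodic; rewrite ?eqxx ?qp ?orbT.
have f1 : bounded1 f by apply: bounded1_prod => q _; apply: local_factor_bounded.
have uP2 : uniq P2 by rewrite filter_uniq.
have pP2 : all prime P2 by apply/allP => p /inP2[].
have dP2 : all (coprime d) P2.
  apply/allP => p /inP2[Dp pps pp po]; rewrite coprime_sym; apply: coprime_prod => q qP1.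
  apply: coprime_ps => //.
    by move: qP1; rewrite !inE => /orP[->//|/inP1[_ -> _ _]]; rewrite orbT.
  apply: contraNneq Dp => pq; move: qP1; rewrite -pq inE => /orP[/eqP p8|/inP1[]//].
  by move: po; rewrite p8.
have := legendre_sieve a N d0 fd f1 uP2 pP2 dP2.
have -> : mean d f = 0.
  have /hasP[p0 p0ps Dp0] := Dps.
  have p0P1 : p0 \in P1 by rewrite mem_filter Dp0.
  have [_ _ pp po] := inP1 _ p0P1.
  have u1 : uniq P1 by rewrite filter_uniq.
  have perm : perm_eq (8%N :: P1) (p0 :: (8%N :: rem p0 P1)).
    apply: (@perm_trans _ (8%N :: p0 :: rem p0 P1)); first by rewrite perm_cons perm_to_rem.
    by rewrite -[8%N :: p0 :: _]/([:: 8%N] ++ [:: p0] ++ _) -[p0 :: 8%N :: _]/([:: p0] ++ [:: 8%N] ++ _) perm_catCA.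
  have dE : d = (p0 * \prod_(q <- 8%N :: rem p0 P1) q)%N by rewrite /d (perm_big _ perm) big_cons.
  rewrite /mean dE; set d' := (\prod_(q <- _) q)%N.
  under eq_bigr do rewrite /f (perm_big _ perm) big_cons.
  have inrem q : q \in 8%N :: rem p0 P1 -> q != p0 /\ q \in 8%N :: P1.
    rewrite !inE mem_rem_uniq// !inE => /orP[/eqP->|/andP[-> ->]]; rewrite ?orbT ?eqxx//.
    by split=> //; apply: contraTneq po => <-.
  rewrite (sum_crt (f := local_factor D p0)
    (g := fun n => \prod_(q <- 8%N :: rem p0 P1) local_factor D q n)).
  - have -> : \sum_(i < p0) local_factor D p0 i = 0; last by rewrite mul0r mul0r.
    rewrite -[RHS](qchar_nat_sum pp po); apply: eq_bigr => i _.
    by rewrite local_factor_odd// Dp0.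
  - apply: coprime_prod => q /inrem[qp0 qP1]; apply: coprime_ps => //.
      by move: qP1; rewrite !inE => /orP[->//|/inP1[_ -> _ _]]; rewrite orbT.
    by rewrite eq_sym.
  - by apply: local_factor_periodic; rewrite pp orbT.
  - apply: periodic_prod => q /inrem[_]; rewrite inE => /orP[/eqP->|/inP1[_ _ qp _]];
      by apply: local_factor_periodic; rewrite ?eqxx ?qp ?orbT.
rewrite mul0r mulr0 subr0.
have -> : twisted_sum D a N =
    \sum_(a <= n < a + N) f n * \prod_(p <- P2) (~~ (p %| n)%N)%:R.
  apply: eq_bigr => n _; rewrite /f !big_cons -mulrA; congr (_ * _).
  rewrite (bigID D) /=; congr (_ * _); rewrite -big_filter//.
  rewrite -/P2 !big_seq; apply: eq_bigr => p /inP2[Dp _ pp po].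
  by rewrite local_factor_odd// (negbTE Dp) qchar_nat_sqr.
move=> H; apply: le_trans H _; rewrite lerBlDr; apply: (@le_trans _ _
  (2 ^ size ps * (32 * \prod_(p <- ps | D p) p))%:R); last by rewrite lerDl.
rewrite ler_nat /d big_cons -/P1 -(big_filter _ D) -/P1 mulnA -mulnA !mulnA leq_mul2r.
by rewrite -!mulnA leq_mul2r leq_pexp2l ?orbT// size_filter count_size.
Qed.

(** A divisor s of the conductor, of size about Y and made of primes above y, carries
    the complete sum; all other moduli are grouped into blocks of size at most Z,
    and differencing removes them one at a time. *)
Lemma twisted_sum_large D a N (y kmax : nat) (Y Z w : R) :
  (8 <= X)%N -> (forall p, p \in ps -> (p <= X)%N) ->
  0 < w -> w <= 1 -> 1 <= Y -> X%:R <= Z ->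
  2 * Z * Y <= N%:R * w ^+ (2 ^ kmax) ->
  X%:R <= (w ^+ (2 ^ kmax)) ^+ 4 * Y ->
  (forall k, (Z / X%:R) ^+ (k - 1) <= (8 * \prod_(p <- ps) p)%:R -> (k <= kmax)%N) ->
  ((24 * 2 ^ kmax) ^ 4 <= y)%N ->
  Y < (\prod_(p <- ps | D p && (y < p)%N) p)%:R ->
  `|twisted_sum D a N| <= 4 * w * N%:R.
Proof.
move=> X8 psX w0 w1 Y1 XZ hN hY hk hy YD.
have X0 : 0 < X%:R :> R by rewrite ltr0n; apply: leq_trans X8.
set Db := [seq p <- ps | D p && (y < p)%N].
have inDb p : p \in Db -> [/\ D p, (y < p)%N, p \in ps, prime p & odd p].
  rewrite mem_filter => /andP[/andP[? ?] pps]; split; by rewrite ?ps_prime ?ps_odd.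
move: YD; rewrite -big_filter -/Db => YD.
have [|T1 [T2 [DbE sY Ys]]] := exists_prefix_prod Y1 X0 _ YD.
  by move=> p /inDb[_ _ pps /prime_gt0 -> _]; rewrite ler_nat psX.
have uDb : uniq Db by rewrite filter_uniq.
have inT1 p : p \in T1 -> [/\ D p, (y < p)%N, p \in ps, prime p & odd p].
  by move=> pT; apply: inDb; rewrite DbE mem_cat pT.
have uT1 : uniq T1 by move: uDb; rewrite DbE cat_uniq => /andP[].
set T := 8%N :: [seq p <- ps | p \notin T1].
have inT q : q \in T -> q = 8%N \/ [/\ q \notin T1, q \in ps, prime q & odd q].
  rewrite inE mem_filter => /orP[/eqP->|/andP[? qps]]; [by left|right].
  by split; rewrite ?ps_prime ?ps_odd.
have perm : perm_eq (8%N :: ps) (T ++ T1).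
  rewrite /T cat_cons perm_cons; apply: uniq_perm => //.
    rewrite cat_uniq uT1 filter_uniq// andbT; apply/hasPn => p pT1.
    by rewrite mem_filter pT1.
  move=> p; rewrite mem_cat mem_filter; case: (boolP (p \in T1)) => [/inT1[]//|_].
  by rewrite orbF.
have [|TT [TE gZ gk]] := exists_grouping X0 XZ (T := T).
  move=> q /inT[->|[_ qps /prime_gt0 q0 _]]; first by rewrite ler_nat.
  by rewrite q0 ler_nat psX.
set rs := [seq (\prod_(q <- g) q)%N | g <- TT].
have krs : (size rs <= kmax)%N.
  rewrite size_map; apply: hk; apply: le_trans gk _; rewrite ler_nat.
  have -> : (8 * \prod_(p <- ps) p = \prod_(p <- 8%N :: ps) p)%N by rewrite big_cons.
  rewrite (perm_big _ perm) big_cat /= leq_pmulr// big_seq prodn_cond_gt0//.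
  by move=> p /inT1[_ _ _ /prime_gt0].
set s := (\prod_(p <- T1) p)%N.
have s0 : (0 < s)%N.
  by rewrite /s big_seq prodn_cond_gt0// => p /inT1[_ _ _ /prime_gt0].
pose psi n := \prod_(p <- T1) qchar_nat R p n.
pose f n := \prod_(q <- T) local_factor D q n.
have fE : twisted_sum D a N = \sum_(a <= n < a + N) f n * psi n.
  apply: eq_bigr => n _; rewrite (perm_big _ perm) big_cat /=; congr (_ * _).
  rewrite /psi !big_seq; apply: eq_bigr => p /inT1[Dp _ _ pp po].
  by rewrite local_factor_odd// Dp.
have Wk : w ^+ (2 ^ kmax) <= w ^+ (2 ^ size rs).
  by apply: ler_wiXn2l; rewrite ?(ltW w0)// leq_pexp2l.
have W0 : 0 <= w ^+ (2 ^ kmax) by rewrite exprn_ge0// ltW.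
have fP : periodic_product rs f.
  rewrite /f -TE; apply: periodic_product_flatten; rewrite TE => q.
    move=> /inT[->|[_ _ qp _]]; apply: local_factor_periodic; by rewrite ?qp ?orbT.
  by move=> _; apply: local_factor_bounded.
have psiP : periodic s psi.
  by apply: periodic_prod => p /inT1[_ _ _ pp _]; apply: qchar_nat_periodic.
have psi1 : bounded1 psi by apply: bounded1_prod => p _; apply: qchar_nat_bounded.
have Y0 : 0 < Y by lra.
have Z1 : 1 <= Z by apply: le_trans XZ; rewrite ler1n; apply: leq_trans X8.
have sZ : (s%:R : R) <= Y by [].
have NW : 2 * Z * Y <= N%:R * w ^+ (2 ^ size rs).
  by apply: le_trans hN _; rewrite ler_wpM2l.
have h1 r : r \in rs -> (2 * r * s)%:R <= N%:R * w ^+ (2 ^ size rs).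
  move=> /mapP[g gTT ->]; apply: le_trans NW; rewrite !natrM.
  by apply: ler_pM => //; rewrite ?mulr_ge0// ler_pM2l// gZ.
have h2 : (2 * s)%:R <= N%:R * w ^+ (2 ^ size rs).
  apply: le_trans NW; rewrite natrM -mulrA ler_pM2l//.
  by apply: le_trans sZ _; rewrite ler_peMl// ltW.
have vdc := weyl_differencing a s0 fP psiP psi1 w0 w1 h1 h2.
rewrite fE; apply: le_trans vdc _.
set W := w ^+ (2 ^ size rs) in Wk *.
have W0' : 0 < W by rewrite exprn_gt0.
set U := cube_mean s rs psi.
have U0 : 0 <= U by apply: cube_mean_ge0.
have US : U ^+ 4 * s%:R <= 1.
  apply: cube_mean_prod_qchar => //; first by apply/allP => p /inT1[].
  move=> p pT1; have [Dp yp pps pp po] := inT1 _ pT1.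
  apply: (local_cube_saving pp po yp krs hy).
  apply/allP => _ /mapP[g gTT ->]; apply: coprime_prod => q qg.
  have qT : q \in T by rewrite -TE; apply/flattenP; exists g.
  apply: coprime_ps => //.
    by case/inT: qT => [->|[_ qps _ _]]; rewrite inE ?eqxx// qps orbT.
  by case/inT: qT => [->|[qT1 _ _ _]]; [apply: contraTneq po => ->|apply: contraNneq qT1 => <-].
(* U^4 s <= 1, while W^4 s >= 1 as s >= Y / X. *)
have UW : U <= W.
  rewrite leNgt; apply/negP => WU.
  have s0R : 0 < s%:R :> R by rewrite ltr0n.
  have : 1 < U ^+ 4 * s%:R.
    apply: (@le_lt_trans _ _ (W ^+ 4 * s%:R)).
      apply: (@le_trans _ _ ((w ^+ (2 ^ kmax)) ^+ 4 * s%:R)).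
        rewrite -(ler_pM2l X0) mulr1 mulrCA; apply: le_trans hY _.
        by rewrite ler_wpM2l// exprn_ge0.
      by rewrite ler_pM2r// lerXn2r// nnegrE// ltW.
    by rewrite ltr_pM2r// ltrXn2r// ?nnegrE// ltW.
  by move=> /lt_le_trans/(_ US); rewrite ltxx.
rewrite mulrC ler_wpM2r// -[X in X <= _]addrC.
have : U * w / W <= w.
  by rewrite ler_pdivrMr// mulrC ler_pM2l.
lra.
Qed.

End CharSums.

(** * Chebyshev's bounds *)

Section Chebyshev.

Local Open Scope nat_scope.

(** primorial x is nprimorial (Num.truncn x) by definition. *)
Definition nprimorial (n : nat) := \prod_(0 <= p < n.+1 | prime p) p.

Lemma nprimorial_gt0 n : 0 < nprimorial n.
Proof. by rewrite /nprimorial prodn_cond_gt0// => p /prime_gt0. Qed.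

Lemma prod_primes_dvd (s : seq nat) (N : nat) :
  uniq s -> (forall p, p \in s -> prime p /\ p %| N) -> \prod_(p <- s) p %| N.
Proof.
elim: s => [|p s IH] /=; first by rewrite big_nil dvd1n.
move=> /andP[ps us] sN; have [pp pN] := sN p (mem_head _ _).
have sN' q : q \in s -> prime q /\ q %| N by move=> qs; apply: sN; rewrite inE qs orbT.
rewrite big_cons Gauss_dvd ?pN ?IH//.
rewrite big_seq; apply: (big_ind (coprime p)); first exact: coprimen1.
  by move=> u v; rewrite coprimeMr => -> ->.
move=> q qs; have [qp _] := sN' q qs; rewrite prime_coprime// dvdn_prime2//.
by apply: contraNneq ps => ->.
Qed.

Lemma prime_dvd_fact p n : prime p -> (p %| n`!) = (p <= n).
Proof.
move=> pp; apply/idP/idP; last first.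
  by move=> pn; rewrite dvdn_fact// prime_gt0.
elim: n => [|n IH]; first by rewrite dvdn1 => /eqP p1; rewrite p1 in pp.
by rewrite factS Euclid_dvdM// => /orP[/dvdn_leq->//|/IH/leqW].
Qed.

(** It occurs twice in the expansion of (1 + 1)^(2m+1). *)
Lemma bin_odd_le m : 'C(2 * m + 1, m) <= 4 ^ m.
Proof.
have := expnDn 1 1 (2 * m + 1).
under eq_bigr do rewrite !exp1n !muln1.
rewrite (addn1 (2 * m)) (bigD1 (inord m)) //= (bigD1 (inord m.+1)) /=; last first.
  by rewrite -val_eqE /= !inordK; lia.
rewrite !inordK; [|lia|lia] => E.
have C2 : 'C((2 * m).+1, m) = 'C((2 * m).+1, m.+1).
  by rewrite -bin_sub; [congr 'C(_, _)|]; lia.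
have E4 : (1 + 1) ^ (2 * m).+1 = 2 * 4 ^ m by rewrite expnS expnM.
by rewrite -(@leq_pmul2l 2)// -E4 E {1}mul2n -addnn {2}C2 addnA leq_addr.
Qed.

(** The primes in (m+1, 2m+1] all divide the binomial coefficient C(2m+1, m). *)
Lemma nprimorial_le n : nprimorial n <= 4 ^ n.
Proof.
elim/ltn_ind: n => n IH.
have step k : k.+1 = n -> ~~ prime k.+1 -> nprimorial n <= 4 ^ n.
  move=> kn kp; rewrite -kn /nprimorial big_mkcond big_nat_recr//= (negbTE kp) muln1.
  rewrite -big_mkcond; apply: leq_trans (IH k _) _; rewrite -?kn//.
  by rewrite leq_pexp2l.
case: (ltnP n 3) => n3.
  case: n n3 {IH step} => [|[|[|]]]// _; rewrite /nprimorial.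
  - by rewrite big_mkcond big_nat1.
  - by rewrite big_mkcond !big_nat_recr//= big_geq.
  - by rewrite big_mkcond !big_nat_recr//= big_geq.
case: (boolP (odd n)) => no; last first.
  case: n n3 no step {IH} => // k k3 ko step; apply: (step k) => //.
  by apply: contraNN ko => kp; case: (even_prime kp) => [k2|//]; rewrite k2 in k3.
pose m := n./2; have nE : n = 2 * m + 1.
  by rewrite -[LHS]odd_double_half no -/m -mul2n addnC.
have mn : m.+2 <= n.+1 by lia.
rewrite /nprimorial (big_cat_nat (n := m.+2)) //=.
have -> : 4 ^ n = 4 ^ m.+1 * 4 ^ m by rewrite -expnD; congr (_ ^ _); lia.
apply: leq_mul; first by apply: IH; lia.
apply: leq_trans (bin_odd_le m); rewrite -big_filter; apply: dvdn_leq.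
  by rewrite bin_gt0; lia.
apply: prod_primes_dvd; first by rewrite filter_uniq// iota_uniq.
move=> p; rewrite mem_filter mem_index_iota => /andP[pp /andP[mp pn]]; split=> //.
have := bin_fact (n := 2 * m + 1) (m := m); rewrite -nE => /(_ _) H.
have : p %| n`! by rewrite prime_dvd_fact.
rewrite -H; last by lia.
by rewrite !Euclid_dvdM// !prime_dvd_fact// => /orP[//|/orP[]]; lia.
Qed.

Lemma expn_size_le_prod y (s : seq nat) : all (leq y) s -> y ^ size s <= \prod_(p <- s) p.
Proof.
elim: s => [|p s IH] /=; first by rewrite big_nil.
by move=> /andP[yp /IH ys]; rewrite big_cons expnS leq_mul.
Qed.

Lemma expn_count_primes_le n y :
  y ^ size [seq p <- iota 0 n.+1 | prime p && (y < p)] <= 4 ^ n.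
Proof.
apply: leq_trans (nprimorial_le n); apply: leq_trans (expn_size_le_prod _) _.
  by apply/allP => p; rewrite mem_filter => /andP[/andP[_ /ltnW]].
rewrite big_filter /nprimorial /index_iota subn0.
rewrite [X in _ <= X](bigID (fun p => y < p)) /= leq_pmulr// prodn_cond_gt0//.
by move=> p /andP[/prime_gt0].
Qed.

Lemma central_bin_ge n : 2 ^ n <= 'C(2 * n, n).
Proof.
elim: n => [|n IH] //; have -> : 2 * n.+1 = (2 * n).+2 by lia.
case: n IH => [|n] IH //.
rewrite binS expnS mul2n -addnn; apply: leq_add; rewrite binS.
  exact: leq_trans IH (leq_addl _ _).
exact: leq_trans IH (leq_addr _ _).
Qed.

(** In Legendre's formula for the valuation of C(2n, n) every term is 0 or 1, and only
    the k with p^k <= 2n contribute. *)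
Lemma logn_central_bin p n : prime p -> 0 < n -> p ^ logn p 'C(2 * n, n) <= 2 * n.
Proof.
move=> pp n0; have p1 := prime_gt1 pp.
apply: leq_trans (trunc_logP p1 (n := 2 * n) _); last by lia.
rewrite leq_pexp2l ?prime_gt0//; set K := trunc_log p (2 * n).
have := congr1 (logn p) (bin_fact (n := 2 * n) (m := n) _).
have -> : 2 * n - n = n by lia.
rewrite !lognM ?muln_gt0 ?fact_gt0 ?bin_gt0 ?leq_pmull//.
move=> /(_ isT); rewrite !logn_fact// => E.
have ext : \sum_(1 <= k < n.+1) n %/ p ^ k = \sum_(1 <= k < (2 * n).+1) n %/ p ^ k.
  rewrite [RHS](big_cat_nat (n := n.+1)) //=; last by lia.
  rewrite [X in _ + X]big_nat_cond [X in _ + X]big1 ?addn0// => k /andP[/andP[nk _] _].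
  by rewrite divn_small// (leq_trans nk)// ltnW// ltn_expl.
rewrite ext addnn -mul2n big_distrr /= in E.
suff : \sum_(1 <= k < (2 * n).+1) (2 * n) %/ p ^ k <=
    K + \sum_(1 <= k < (2 * n).+1) 2 * (n %/ p ^ k) by rewrite -E leq_add2r.
apply: (@leq_trans (\sum_(1 <= k < (2 * n).+1) ((k <= K) + 2 * (n %/ p ^ k)))).
  rewrite big_nat_cond [X in _ <= X]big_nat_cond; apply: leq_sum => k _.
  have pk : 0 < p ^ k by rewrite expn_gt0 prime_gt0.
  case: (leqP k K) => kK.
    have := divn_eq n (p ^ k); have := ltn_pmod n pk => h1 h2.
    rewrite /= -ltnS ltn_divLR//; move: h1 h2; clear.
    by move: (n %/ p ^ k) (n %% p ^ k) (p ^ k) => u v w; lia.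
  rewrite divn_small//; apply: leq_trans (trunc_log_ltn _ p1) _.
  by rewrite leq_pexp2l// prime_gt0.
rewrite big_split /= leq_add2r.
case: (leqP K (2 * n)) => KN.
  rewrite (big_cat_nat (n := K.+1)) //= [X in _ + X]big_nat_cond [X in _ + X]big1.
    rewrite addn0; apply: (@leq_trans (\sum_(1 <= k < K.+1) 1)).
      by apply: leq_sum => k _; apply: leq_b1.
    by rewrite sum_nat_const_nat subn1 muln1.
  by move=> k /andP[/andP[Kk _] _]; rewrite leqNgt Kk.
apply: (@leq_trans (\sum_(1 <= k < (2 * n).+1) 1)).
  by apply: leq_sum => k _; apply: leq_b1.
by rewrite sum_nat_const_nat subn1 muln1 /= ltnW.
Qed.

(** Chebyshev's argument: p^(v_p) <= 2n for every prime power exactly dividing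
    C(2n, n), so primes above sqrt(2n) occur once. *)
Lemma nprimorial_ge n r : 0 < n -> 2 * n < r.+1 ^ 2 ->
  2 ^ n <= nprimorial (2 * n) * (2 * n) ^ r.
Proof.
move=> n0 nr; apply: leq_trans (central_bin_ge n) _.
set C := 'C(2 * n, n); have C0 : 0 < C by rewrite bin_gt0 leq_pmull.
rewrite {1}(prod_prime_decomp C0) prime_decompE big_map /=.
apply: (@leq_trans (\prod_(p <- primes C) (p * (if p <= r then 2 * n else 1)))).
  rewrite !big_seq; apply: leq_prod => p; rewrite mem_primes => /and3P[pp _ pC].
  case: (leqP p r) => pr.
    by apply: leq_trans (logn_central_bin pp n0) _; rewrite leq_pmull// prime_gt0.
  rewrite muln1 -[X in _ <= X]expn1 leq_pexp2l ?prime_gt0// leqNgt; apply/negP => l2.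
  have : p ^ 2 <= 2 * n.
    by apply: leq_trans (logn_central_bin pp n0); rewrite leq_pexp2l// prime_gt0.
  by rewrite leqNgt (leq_trans nr)// leq_exp2r.
rewrite big_split /=; apply: leq_mul.
  apply: dvdn_leq (nprimorial_gt0 _) _; apply: prod_primes_dvd (primes_uniq _) _.
  move=> p; rewrite mem_primes => /and3P[pp _ pC]; split=> //.
  rewrite /nprimorial big_mkcond (bigD1_seq p) ?iota_uniq ?mem_index_iota//=.
    by rewrite pp dvdn_mulr.
  rewrite ltnS -prime_dvd_fact//; apply: dvdn_trans pC _.
  have <- := bin_fact (n := 2 * n) (m := n) (leq_pmull _ _) => //.
  by rewrite dvdn_mulr.
apply: (@leq_trans (\prod_(p <- [seq p <- primes C | p <= r]) (2 * n))).
  by rewrite big_filter -big_mkcond.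
rewrite big_const_seq count_predT iter_muln_1 leq_pexp2l ?muln_gt0//.
have := @uniq_leq_size _ [seq p <- primes C | p <= r] (iota 1 r); rewrite size_iota; apply.
  by rewrite filter_uniq ?primes_uniq.
move=> p; rewrite mem_filter mem_primes mem_iota => /andP[pr /andP[/prime_gt0 p0 _]].
by rewrite p0 add1n ltnS.
Qed.

End Chebyshev.

(** * Residue patterns *)

Section Legendre.
Variables (p : nat) (p_pr : prime p) (p_odd : odd p).

Lemma qchar_square (y : 'F_p) : y != 0 -> qchar (y ^+ 2) = 1.
Proof.
move=> y0; rewrite expr2 (qcharM p_pr p_odd).
by move: y0; rewrite -qchar_eq0; case/or3P: (qchar_val y) => /eqP ->.
Qed.

(** There are at least (p-1)/2 nonzero squares, since squaring is at most
    two-to-one, and exactly (p-1)/2 elements of character 1, since the character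
    sums to zero. *)
Lemma qchar1_square (z : 'F_p) : qchar z = 1 -> exists y : 'F_p, y ^+ 2 = z.
Proof.
move=> z1.
pose A := [set y : 'F_p | y != 0]; pose S := [set y ^+ 2 | y in A].
pose V (e : int) := [set x : 'F_p | qchar x == e].
have SV : S \subset V 1.
  by apply/fintype.subsetP => _ /imsetP[y yA ->]; rewrite inE qchar_square//; rewrite inE in yA.
have cA : #|A| = (#|V 1%R| + #|V (-1)%R|)%N.
  rewrite -cardsUI [X in (_ + #|pred_of_set X|)%N](_ : _ = finset.set0) ?cards0 ?addn0.
    apply: eq_card => y; rewrite !inE -qchar_eq0.
    by case/or3P: (qchar_val y) => /eqP ->.
  by apply/finset.setP => y; rewrite !inE; case/or3P: (qchar_val y) => /eqP ->.
have VV : #|V 1| = #|V (-1)|.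
  have := sum_qchar p_pr p_odd.
  have -> : \sum_(x : 'F_p) qchar x = #|V 1|%:Z - #|V (-1)|%:Z.
    rewrite -!sum1_card !(big_morph Posz PoszD (erefl _)) [X in X - _]big_mkcond.
    rewrite [X in _ - X]big_mkcond -sumrB; apply: eq_bigr => x _; rewrite !inE.
    by case/or3P: (qchar_val x) => /eqP ->.
  by move/eqP; rewrite subr_eq0 => /eqP[].
have AS : (#|A| <= 2 * #|S|)%N.
  rewrite -sum1_card (partition_big_imset (fun y : 'F_p => y ^+ 2)) /= -/S.
  rewrite mulnC -sum_nat_const; apply: leq_sum => _ /imsetP[y yA ->].
  rewrite sum1_card; apply: (@leq_trans #|[set y; - y]|).
    apply: subset_leq_card; apply/fintype.subsetP => x; rewrite unfold_in => /andP[_].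
    by rewrite eqf_sqr !inE.
  by rewrite cards2; case: (_ != _).
have SE : S = V 1.
  apply/eqP; rewrite eqEcard SV /=.
  by move: AS; rewrite cA -VV addnn -mul2n leq_pmul2l.
have : z \in S by rewrite SE inE z1.
by move=> /imsetP[y _ ->]; exists y.
Qed.

Lemma natr_Fp_eq (m n : nat) : ((m%:R : 'F_p) == n%:R) = (m == n %[mod p])%N.
Proof. by rewrite -val_eqE /= !val_Fp_nat. Qed.

(** Euler's criterion for the symbol defined by the existence of a square root. *)
Lemma legendre_qchar (n : nat) : (legendre n%:Z p == 1) = (qchar (n%:R : 'F_p) == 1).
Proof.
rewrite /legendre dvdzE /= (dvdn_pcharf (pchar_Fp p_pr)).
have [n0|n0] := boolP (_ == 0); first by rewrite (eqP n0) qchar0.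
have sqE (y : 'I_p) : ((y : nat)%:Z ^+ 2 == n%:Z %[mod p])%Z =
    (((y : nat)%:R : 'F_p) ^+ 2 == n%:R).
  by rewrite -natrX natr_Fp_eq expr2 -PoszM !modz_nat eqz_nat mulnn.
case: existsP => [[y]|no].
  rewrite sqE => /eqP yn; rewrite -yn qchar_square ?eqxx//.
  by apply: contraNneq n0 => y0; rewrite -yn y0 expr0n.
rewrite eq_sym; apply/esym; case: eqP => [q1|//]; exfalso; apply: no.
have [y yn] := qchar1_square q1.
have yp : (y < p)%N by have := ltn_ord y; rewrite {2}(Fp_cast p_pr).
exists (Ordinal yp); rewrite sqE /= -yn; apply/eqP; congr (_ ^+ 2).
by apply/val_inj; rewrite /= val_Fp_nat// modn_small.
Qed.

End Legendre.

Section Expansion.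
Variable R : realFieldType.
Variables (ps : seq nat).
Hypotheses (ps_uniq : uniq ps) (ps_prime : forall p, p \in ps -> prime p)
  (ps_odd : forall p, p \in ps -> odd p).

Definition residue_pattern (n : nat) : bool :=
  (n %% 8 == 1)%N && all (fun p => legendre n%:Z p == 1) ps.

(** Sets of positions in ps index the expansion; this converts them to predicates on
    primes. *)
Definition selected (J : {set 'I_(size ps)}) : pred nat :=
  fun q => [exists i in J, nth 0%N ps (i : nat) == q].

Lemma selected_nth (J : {set 'I_(size ps)}) (i : 'I_(size ps)) :
  selected J (nth 0%N ps i) = (i \in J).
Proof.
apply/existsP/idP => [[j /andP[jJ]]|iJ]; last by exists i; rewrite iJ eqxx.
by rewrite nth_uniq// => /eqP ij; rewrite -(val_inj ij).
Qed.

(** chi + chi^2 is 2 where the symbol chi is 1, and 0 where it is 0 or -1. *)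
Lemma residue_pattern_expand (n : nat) :
  2 ^+ size ps * (residue_pattern n)%:R =
  \sum_(J : {set 'I_(size ps)})
    \prod_(q <- 8%N :: ps) local_factor R (selected J) q n.
Proof.
have -> : 2 ^+ size ps * (residue_pattern n)%:R =
    (n %% 8 == 1)%N%:R * \prod_(p <- ps) (qchar_nat R p n + qchar_nat R p n ^+ 2).
  rewrite /residue_pattern; case: eqP => _; last by rewrite mulr0 mul0r.
  rewrite mul1r andTb; elim: ps ps_prime ps_odd => [|p s IH] pp po.
    by rewrite expr0 big_nil mulr1.
  have pp' : prime p by apply: pp; rewrite mem_head.
  have po' : odd p by apply: po; rewrite mem_head.
  rewrite big_cons -IH; last 2 first.
  - by move=> q qs; apply: pp; rewrite inE qs orbT.
  - by move=> q qs; apply: po; rewrite inE qs orbT.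
  rewrite /= (legendre_qchar pp' po') /qchar_nat exprS.
  case/or3P: (qchar_val (n%:R : 'F_p)) => /eqP ->.
  - by rewrite expr0n addr0 mul0r mulr0.
  - by rewrite expr1n mulrA.
  - by rewrite mulrN1z sqrrN expr1n addNr mul0r mulr0.
rewrite (big_nth 0%N) big_mkord bigA_distr mulr_sumr; apply: eq_bigr => J _.
rewrite big_cons; congr (_ * _).
rewrite [RHS](big_nth 0%N) big_mkord; apply: eq_bigr => i _.
have pips : nth 0%N ps i \in ps by rewrite mem_nth.
by rewrite local_factor_odd ?ps_prime ?ps_odd// selected_nth.
Qed.

Definition pattern_density : R :=
  (2 ^+ size ps)^-1 * (8^-1 * \prod_(p <- ps) (1 - p%:R^-1)).

(** The empty set of primes gives the main term, with mean 1/8 over a period. *)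
Lemma count_residue_pattern (a N : nat) (E : R) :
  (forall D, has D ps -> `|twisted_sum R ps D a N| <= E) ->
  (2 ^ size ps * 32)%:R <= E ->
  `|2 ^+ size ps * \sum_(a <= n < a + N) (residue_pattern n)%:R
    - N%:R * (8^-1 * \prod_(p <- ps) (1 - p%:R^-1))| <= 2 ^+ size ps * E.
Proof.
move=> hE hE0.
rewrite mulr_sumr (eq_bigr _ (fun n _ => residue_pattern_expand n)).
rewrite exchange_big /= (bigD1 finset.set0)//= addrAC.
have E0 : `|twisted_sum R ps (selected finset.set0) a N
    - N%:R * (8^-1 * \prod_(p <- ps) (1 - p%:R^-1))| <= E.
  have prps : all prime ps by apply/allP.
  have cps : all (coprime 8) ps.
    by apply/allP => p pps; rewrite (@coprimeXl 3 2)// coprime2n ps_odd.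
  have e8 : periodic 8 (local_factor R pred0 8) by apply: local_factor_periodic.
  have := legendre_sieve a N (isT : 0 < 8)%N e8 (local_factor_bounded _ _ _) ps_uniq prps cps.
  have -> : mean 8 (local_factor R pred0 8) = 8^-1.
    by rewrite /mean !big_ord_recl big_ord0 /local_factor /= !add0r !addr0 mul1r.
  have -> : \sum_(a <= n < a + N) local_factor R pred0 8 n * \prod_(p <- ps) (~~ (p %| n)%N)%:R =
      twisted_sum R ps (selected finset.set0) a N.
    apply: eq_bigr => n _; rewrite big_cons; congr (_ * _).
    rewrite !big_seq; apply: eq_bigr => p pps.
    rewrite local_factor_odd ?ps_prime ?ps_odd// qchar_nat_sqr ?ps_prime//.
    have -> // : selected finset.set0 p = false.
    by apply/existsP => -[i]; rewrite inE.
  move=> h; apply: le_trans h _; apply: le_trans hE0; rewrite lerBlDr.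
  by rewrite -[(4 * 8)%N]/32%N lerDl.
apply: le_trans (ler_normD _ _) _.
have -> : 2 ^+ size ps * E = E + \sum_(J : {set 'I_(size ps)} | J != finset.set0) E.
  have -> : E + \sum_(J : {set 'I_(size ps)} | J != finset.set0) E =
    \sum_(J : {set 'I_(size ps)}) E by rewrite [RHS](bigD1 finset.set0).
  have c : #|{: {set 'I_(size ps)}}| = (2 ^ size ps)%N.
    by rewrite -cardsT -finset.powersetT card_powerset cardsT card_ord.
  by rewrite sumr_const c -(mulr_natl E) natrX.
apply: lerD E0 _; apply: le_trans (ler_norm_sum _ _ _) _.
apply: ler_sum => J J0; apply: hE.
have /finset.set0Pn[i iJ] := J0.
by apply/hasP; exists (nth 0%N ps i); rewrite ?mem_nth// selected_nth.
Qed.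

End Expansion.

(** * Counting pseudosquares *)

Definition odd_primes (n : nat) : seq nat := [seq p <- iota 0 n.+1 | prime p && odd p].

(** If j0^2 is the first square that is at least a, then (j0 + r + 1)^2 exceeds
    j0^2 + r^2. *)
Lemma count_squares_le (a M r : nat) (s : seq nat) : uniq s -> (M <= r ^ 2)%N ->
  (forall n, n \in s -> (a <= n < a + M)%N /\ exists j, n = (j ^ 2)%N) ->
  (size s <= r.+1)%N.
Proof.
move=> us Mr sS.
have ex : exists j, (a <= j ^ 2)%N by exists a; rewrite -mulnn; case: (a) => // k; rewrite leq_pmull.
case: (ex_minnP ex) => j0 j0a j0min.
rewrite -[r.+1](size_iota 0) -(size_map (fun i => (j0 + i) ^ 2)%N (iota 0 r.+1)).
apply: uniq_leq_size => // n /sS[/andP[an nM] [j nE]].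
have jj : (j0 <= j)%N by apply: j0min; rewrite -nE.
apply/mapP; exists (j - j0)%N; last by rewrite subnKC.
rewrite mem_iota /= add0n ltnS leqNgt; apply/negP => rj.
have : (j0 ^ 2 + r ^ 2 <= j ^ 2)%N.
  have /(leq_trans _) : (j0 + (j - j0) <= j)%N by rewrite subnKC.
  move=> _; have jE : j = (j0 + (j - j0))%N by rewrite subnKC.
  rewrite [in leqRHS]jE -!mulnn; move: rj; move: (j - j0)%N => k; clear; nia.
by move: nM nE j0a Mr; clear; lia.
Qed.

Section Count.
Variable R : realType.

Lemma pseudosquare_count_bounds (x A N : R) (r : nat) :
  0 <= x -> 0 <= A -> 0 <= N ->
  let a := (Num.truncn A).+1 in let M := (Num.truncn (A + N) - Num.truncn A)%N in
  let T := (\sum_(a <= n < a + M) residue_pattern (odd_primes (Num.truncn x)) n)%N in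
  (M <= r ^ 2)%N ->
  (pseudosquare_count x A (A + N) <= T <= pseudosquare_count x A (A + N) + r.+1)%N.
Proof.
move=> x0 A0 N0 a M T Mr.
pose isq (n : nat) := `[< exists m : nat, n = (m ^ 2)%N >].
pose pat n := residue_pattern (odd_primes (Num.truncn x)) n.
pose I := index_iota a (a + M).
have tA : (Num.truncn A <= Num.truncn (A + N))%N by apply: le_truncn; rewrite lerDl.
have memI n : (n \in I) = (A < n%:R <= A + N).
  rewrite /I mem_index_iota /a /M addSn subnKC// ltnS truncn_ge_nat ?addr_ge0//.
  by rewrite -truncn_lt_nat.
have TE : T = size [seq n <- I | pat n] by rewrite size_filter -sum1_count big_mkcond.
have patP n : is_pseudosquare x n <-> pat n && ~~ isq n && (0 < n)%N.
  rewrite /is_pseudosquare /pat /residue_pattern; split.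
    move=> [n0 nsq n8 nl]; rewrite n0 n8 /= !andbT; apply/andP; split.
      apply/allP => p; rewrite mem_filter mem_iota add0n ltnS /= => /andP[/andP[pp po] px].
      by apply/eqP/nl => //; rewrite -truncn_ge_nat.
    by apply/asboolP.
  move=> /andP[/andP[/andP[/eqP n8 /allP nl] /asboolP nsq] n0]; split=> //.
  move=> p pp po px; apply/eqP/nl; rewrite mem_filter pp po mem_iota add0n ltnS /=.
  by rewrite truncn_ge_nat.
have cE : pseudosquare_count x A (A + N) = size [seq n <- I | pat n && ~~ isq n].
  rewrite /pseudosquare_count; apply: perm_size; apply: uniq_perm.
  - exact: fset_uniq.
  - by rewrite filter_uniq// iota_uniq.
  move=> n; rewrite in_fset_set; last by apply: finite_setIr; apply: finite_nat_oc.
  rewrite mem_filter memI; apply/idP/idP.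
    rewrite inE => -[/patP/andP[-> _] nI] //.
  move=> /andP[pn nI]; rewrite inE; split=> //; apply/patP; rewrite pn /=.
  by move: nI; rewrite -memI mem_index_iota => /andP[/(leq_trans _)->].
have TS : T = (size [seq n <- I | pat n && ~~ isq n] + size [seq n <- I | pat n && isq n])%N.
  rewrite TE !size_filter; elim: I {memI TE cE} => //= n s IH.
  by case: (pat n); case: (isq n); rewrite /= IH ?addnS ?addSn ?add0n.
have sq : (size [seq n <- I | pat n && isq n] <= r.+1)%N.
  apply: (@count_squares_le a M) => //; first by rewrite filter_uniq// iota_uniq.
  move=> n; rewrite mem_filter mem_index_iota => /andP[/andP[_ /asboolP nsq] ->].
  by split.
by rewrite TS cE leq_addr leq_add2l.
Qed.

Lemma truncn_interval_length (A N : R) : 0 <= A -> 0 <= N ->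
  `|(Num.truncn (A + N) - Num.truncn A)%N%:R - N| <= 1.
Proof.
move=> A0 N0; have AN := addr_ge0 A0 N0.
have tA : (Num.truncn A <= Num.truncn (A + N))%N by apply: le_truncn; rewrite lerDl.
have /andP[a1 a2] := truncn_itv A0; have /andP[b1 b2] := truncn_itv AN.
rewrite natrB// ler_norml; move: a1 a2 b1 b2; rewrite -!natr1 => a1 a2 b1 b2.
by apply/andP; split; lra.
Qed.

End Count.

(** * Comparison of scales *)

Section Scales.
Variable R : realType.

Lemma expR_ge_pow (k : nat) (y : R) : (0 < k)%N -> 0 <= y -> (y / k%:R) ^+ k <= expR y.
Proof.
move=> k0 y0; have k0R : 0 < k%:R :> R by rewrite ltr0n.
have -> : expR y = expR (y / k%:R) ^+ k by rewrite -expRM_natl mulrC divfK ?gt_eqF.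
have yk : 0 <= y / k%:R by rewrite divr_ge0// ltW.
rewrite lerXn2r// ?nnegrE ?expR_ge0//; apply: le_trans (expR_ge1Dx _).
by rewrite lerDr.
Qed.

Lemma ler_expn (n : nat) (a b : R) : 0 <= a -> a <= b -> a ^+ n <= b ^+ n.
Proof. by move=> a0 ab; rewrite lerXn2r// nnegrE// (le_trans a0). Qed.

(** It matters that 2 * 0.74 < 3/2: twice this exponent bounds the logarithm of the
    product of the primes up to x, divided by x. *)
Lemma expR_ge2 : 2 <= expR (74 / 100) :> R.
Proof.
have h := expR_ge1Dx (74 / 100 / 8%:R : R).
have -> : expR (74 / 100) = expR (74 / 100 / 8%:R) ^+ 8 :> R.
  by rewrite -expRM_natl; congr expR; field.
apply: (@le_trans _ _ ((437 / 400) ^+ 8)); first by rewrite !exprS expr0; lra.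
by apply: ler_expn; lra.
Qed.

Lemma natX2_le (k : nat) : (2 ^ k)%:R <= expR (74 / 100 * k%:R) :> R.
Proof.
by rewrite expRM_natr natrX; apply: ler_expn (expR_ge2).
Qed.

Lemma natX2_ge (k : nat) : expR (1 / 2 * k%:R) <= (2 ^ k)%:R :> R.
Proof.
rewrite expRM_natr natrX; apply: ler_expn (expR_ge0 _) _.
have e0 : 0 < expR (1 / 2) :> R by apply: expR_gt0.
have h := expR_ge1Dx (- (1 / 2) : R); rewrite expRN in h.
have : expR (1 / 2) * (expR (1 / 2))^-1 = 1 :> R by rewrite divff ?gt_eqF.
by move: (expR (1 / 2)) (expR (1 / 2))^-1 e0 h => a b a0 h; nra.
Qed.

(** Here u = log log x, l = log x and s = sqrt x.  The main scale is v = x / log log x;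
    x / log x, sqrt x and log x are all negligible against it. *)
Lemma scale_inequalities (u : R) : 100 * 1000 <= u ->
  let l := expR u in let s := expR (l / 2) in let x := expR l in let v := x / u in
  [/\ 1000 * u <= expR (26 / 100 * u), 24 ^+ 4 * l ^+ 3 + 1 <= s & x = s ^+ 2] /\
  [/\ 1000 <= v, x / l <= v / 1000, s <= v / 1000, s <= x / l / 1000 & l <= v / 1000].
Proof.
move=> hu l s x v.
have u0 : 0 < u by lra.
have h1 : 1000 * u <= expR (26 / 100 * u).
  have := @expR_ge_pow 2 (26 / 100 * u) isT ltac:(lra); apply: le_trans.
  by rewrite expr2; nra.
have l1 : (25 * 1000) ^+ 4 <= l.
  have := @expR_ge_pow 4 u isT (ltW u0); apply: le_trans.
  by apply: ler_expn; lra.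
have lul : 1000 * u <= l.
  by apply: le_trans h1 _; rewrite ler_expR; lra.
have l0 : 0 < l by apply: expR_gt0.
have h2 : 24 ^+ 4 * l ^+ 3 + 1 <= s.
  have := @expR_ge_pow 4 (l / 2) isT ltac:(lra); apply: le_trans.
  have l3 : 1 <= l ^+ 3 by rewrite exprn_ege1//; apply: le_trans l1; rewrite !exprS expr0; lra.
  have -> : (l / 2 / 4%:R) ^+ 4 = l ^+ 3 * (l / 8 ^+ 4) by field.
  have : l ^+ 3 * (24 ^+ 4 + 1) <= l ^+ 3 * (l / 8 ^+ 4).
    rewrite ler_pM2l; last lra.
    rewrite ler_pdivlMr ?exprn_gt0//; apply: le_trans l1.
    by rewrite !exprS !expr0; lra.
  lra.
have xE : x = s ^+ 2 by rewrite /x /s -expRM_natl; congr expR; field.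
have s1 : 1000 * l <= s.
  apply: le_trans h2; have : l <= l ^+ 3.
    by rewrite -[X in X <= _]expr1 ler_weXn2l//; apply: le_trans l1; rewrite !exprS expr0; lra.
  by rewrite !exprS !expr0; lra.
have s0 : 0 < s by apply: expR_gt0.
have l1000 : 1000 <= l by apply: le_trans l1; rewrite !exprS expr0; lra.
split; split=> //.
- by rewrite /v ler_pdivlMr// xE expr2; nra.
- have x0 : 0 <= x / l by rewrite divr_ge0 ?expR_ge0// ltW.
  have xl : x = (x / l) * l by rewrite divfK ?gt_eqF.
  rewrite /v ler_pdivlMr; last lra.
  rewrite ler_pdivlMr; last exact: u0.
  by rewrite -mulrA {2}xl; apply: ler_wpM2l.
- rewrite /v ler_pdivlMr; last lra.
  rewrite ler_pdivlMr; last exact: u0.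
  by rewrite xE expr2 -mulrA; apply: ler_wpM2l; [exact: ltW|lra].
- rewrite ler_pdivlMr; last lra.
  rewrite ler_pdivlMr; last exact: l0.
  by rewrite xE expr2 -mulrA; apply: ler_wpM2l; [exact: ltW|lra].
- rewrite /v ler_pdivlMr; last lra.
  rewrite ler_pdivlMr; last exact: u0.
  by rewrite xE expr2 -mulrA; apply: ler_pM; lra.
Qed.

End Scales.

Lemma prime_dvd_nprimorial p n : prime p -> (p <= n)%N -> (p %| nprimorial n)%N.
Proof.
move=> pp pn; rewrite /nprimorial big_mkcond (bigD1_seq p) ?iota_uniq//=.
  by rewrite pp dvdn_mulr.
by rewrite mem_index_iota ltnS.
Qed.

Lemma nprimorial_mono m n : (m <= n)%N -> (nprimorial m <= nprimorial n)%N.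
Proof.
move=> mn; rewrite /nprimorial (big_cat_nat (n := m.+1) (p := n.+1)) //=.
by rewrite leq_pmulr// prodn_cond_gt0// => p /prime_gt0.
Qed.

Lemma prod_primes_le_nprimorial (s : seq nat) n : uniq s ->
  (forall p, p \in s -> prime p /\ (p <= n)%N) -> (\prod_(p <- s) p <= nprimorial n)%N.
Proof.
move=> us sn; apply: dvdn_leq (nprimorial_gt0 n) _; apply: prod_primes_dvd => // p ps.
by have [pp pn] := sn p ps; split=> //; apply: prime_dvd_nprimorial.
Qed.

Lemma size_odd_primes_le n y :
  (size (odd_primes n) <= y.+1 + size [seq p <- iota 0 n.+1 | prime p && (y < p)])%N.
Proof.
rewrite -{1}(size_iota 0 y.+1) -size_cat; apply: uniq_leq_size.
  by rewrite filter_uniq// iota_uniq.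
move=> p; rewrite mem_cat !mem_filter !mem_iota !add0n /= => /andP[/andP[-> _] ->].
by rewrite andbT ltnS; case: (leqP p y).
Qed.

(** * Estimates for large x *)

Section Large.
Variable R : realType.
(* u = log log x, l = log x, s = sqrt x, v = x / log log x and q = x / log x.  They are
   independent variables tied by equations, so that arithmetic tactics see them as
   atoms. *)
Variables u l s x v q : R.
Hypotheses (hu : 100 * 1000 <= u) (lE : l = expR u) (sE : s = expR (l / 2))
  (xE : x = expR l) (vu : v * u = x) (ql : q * l = x)
  (h1 : 1000 * u <= expR (26 / 100 * u)) (h2 : 24 ^+ 4 * l ^+ 3 + 1 <= s)
  (xs : x = s ^+ 2) (v1000 : 1000 <= v) (qv : q <= v / 1000) (sv : s <= v / 1000)
  (sq : s <= q / 1000) (lv : l <= v / 1000).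

Let n := Num.truncn x.
Let y := Num.truncn s.
Let ps := odd_primes n.
Let kmax := Num.truncn u.
Let w := expR (- (10 * q)).

Let l0 : 0 < l. Proof. by rewrite lE expR_gt0. Qed.
Let s0 : 0 < s. Proof. by rewrite sE expR_gt0. Qed.
Let x0 : 0 < x. Proof. by rewrite xE expR_gt0. Qed.
Let u0 : 0 < u. Proof. by move: hu; lra. Qed.
Let q0 : 0 < q.
Proof. have ql0 : 0 < q * l by rewrite ql. by move: ql0; rewrite pmulr_lgt0. Qed.

Let nx : n%:R <= x /\ x < n%:R + 1.
Proof. by have /andP[a b] := truncn_itv (ltW x0); rewrite natr1. Qed.
Let ys : y%:R <= s /\ s < y%:R + 1.
Proof. by have /andP[a b] := truncn_itv (ltW s0); rewrite natr1. Qed.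
Let ku : kmax%:R <= u /\ u < kmax%:R + 1.
Proof. by have /andP[a b] := truncn_itv (ltW u0); rewrite natr1. Qed.

Let l1 : 1 <= l.
Proof. by rewrite lE; apply: le_trans (expR_ge1Dx u); move: u0; lra. Qed.

Let s24 : 24 ^+ 4 <= s.
Proof.
apply: le_trans h2; have : 1 <= l ^+ 3 by rewrite exprn_ege1.
by rewrite !exprS !expr0; lra.
Qed.

Let s2 : 1000 <= s.
Proof. by apply: le_trans s24; rewrite !exprS expr0; lra. Qed.

Let pow4_le m : (4 ^ m)%:R <= expR (148 / 100 * m%:R) :> R.
Proof.
have -> : (4 ^ m = 2 ^ (2 * m))%N by rewrite expnM.
apply: le_trans (natX2_le _ _) _; rewrite ler_expR natrM; lra.
Qed.

(** The primes in (y, n] have product at most 4^n, and y is about sqrt n. *)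
Lemma size_primes_bound : (size ps)%:R <= 6 * q.
Proof.
set c := size [seq p <- iota 0 n.+1 | prime p && (y < p)%N].
have h := size_odd_primes_le n y; rewrite -/c in h.
have [y1 y2] := ys; have [n1 n2] := nx.
have cq : c%:R * (l / 4) <= 148 / 100 * x.
  have : expR (l / 4 * c%:R) <= expR (148 / 100 * n%:R).
    apply: le_trans (pow4_le n); apply: (@le_trans _ _ (y ^ c)%:R).
      rewrite expRM_natr natrX; apply: ler_expn; first exact: expR_ge0.
      have e4 : s = expR (l / 4) ^+ 2 by rewrite sE -expRM_natl; congr expR; field.
      have := expR_ge0 (l / 4); move: e4 s2 y2; rewrite expr2.
      by move: (expR _) => e; nra.
    by rewrite ler_nat; apply: expn_count_primes_le.
  by rewrite ler_expR; move: n1; lra.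
have cq2 : c%:R <= 592 / 100 * q.
  by rewrite -(ler_pM2r l0) -[leRHS]mulrA ql; move: cq; lra.
have : (size ps)%:R <= (y.+1 + c)%:R :> R by rewrite ler_nat.
rewrite natrD -natr1; move: cq2 y1 sq s2; lra.
Qed.

Let w0 : 0 < w. Proof. exact: expR_gt0. Qed.
Let w1 : w <= 1. Proof. by rewrite /w expR_le1; move: q0; lra. Qed.

(** 2^kmax is at most (log x)^0.74, so w^(2^kmax) is still exp (-o(v)). *)
Lemma pow_w_bound : expR (- (v / 100)) <= w ^+ (2 ^ kmax).
Proof.
rewrite /w -expRM_natr ler_expR.
have [k1 k2] := ku.
have K : (2 ^ kmax)%:R <= expR (74 / 100 * u) :> R.
  by apply: le_trans (natX2_le _ _) _; rewrite ler_expR; move: k1; lra.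
have lEE : l = expR (74 / 100 * u) * expR (26 / 100 * u).
  by rewrite lE -expRD; congr expR; field.
have qK : q * (2 ^ kmax)%:R * (1000 * u) <= v * u.
  rewrite vu -ql lEE -mulrA; apply: ler_wpM2l; first exact: ltW.
  by apply: ler_pM; [exact: ler0n|move: u0; lra|exact: K|exact: h1].
have : q * (2 ^ kmax)%:R * 1000 <= v.
  by rewrite -(ler_pM2r u0) -[leLHS]mulrA.
by rewrite mulNr -(mulrA 10); move: (q * _) => z; lra.
Qed.

Let inps p : p \in ps -> [/\ prime p, odd p & (p <= n)%N].
Proof. by rewrite mem_filter mem_iota add0n ltnS => /andP[/andP[-> ->]]. Qed.
Let ups : uniq ps. Proof. by rewrite filter_uniq// iota_uniq. Qed.

Let v0 : 0 < v. Proof. by move: v1000; lra. Qed.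

(** The product of all moduli is at most e^(1.48 x + O(1)), each closed group
    contributes about e^(1.5 v), and u v = x: hence at most u groups. *)
Lemma groups_bound k :
  (expR (3 / 2 * v) / n%:R) ^+ (k - 1) <= (8 * \prod_(p <- ps) p)%:R :> R -> (k <= kmax)%N.
Proof.
move=> h; rewrite leqNgt; apply/negP => kk.
have [k1 k2] := ku; have [n1 n2] := nx.
have n0 : 0 < n%:R :> R by move: n2 xs s2; rewrite expr2; nra.
have up : (8 * \prod_(p <- ps) p)%:R <= expR (222 / 100 + 148 / 100 * x) :> R.
  apply: (@le_trans _ _ (8 * 4 ^ n)%:R).
    rewrite ler_nat leq_mul2l /=; apply: leq_trans (nprimorial_le n).
    by apply: prod_primes_le_nprimorial => // p /inps[].
  rewrite natrM expRD; apply: ler_pM => //.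
    apply: le_trans (natX2_le R 3) _.
    by rewrite ler_expR; lra.
  by apply: le_trans (pow4_le n) _; rewrite ler_expR; move: n1; lra.
have low : expR (3 / 2 * v - l) ^+ (k - 1) <= (expR (3 / 2 * v) / n%:R) ^+ (k - 1).
  apply: ler_expn; first exact: expR_ge0.
  rewrite expRB; apply: ler_wpM2l; first exact: expR_ge0.
  by rewrite lef_pV2 ?posrE ?expR_gt0// -xE.
have := le_trans low (le_trans h up); rewrite -expRM_natl ler_expR.
have ku1 : u - 1 <= (k - 1)%:R.
  rewrite natrB; last by apply: leq_trans kk.
  by have : kmax.+1%:R <= k%:R :> R; [rewrite ler_nat|rewrite -natr1; move: k2; lra].
have vl : 0 <= 3 / 2 * v - l by move: lv v1000; lra.
have := ler_wpM2r vl ku1.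
have lu : l * u <= x / 1000.
  by rewrite -vu mulrAC; apply: ler_wpM2r; [exact: ltW|exact: lv].
have vx : 100 * 1000 * v <= x by rewrite -vu mulrC; apply: ler_wpM2l; [exact: ltW|].
move: (k - 1)%:R => K a b.
have : (u - 1) * (3 / 2 * v - l) = 3 / 2 * x - 3 / 2 * v - l * u + l by rewrite -vu; ring.
move: a b lu vx v1000 l0; move: (_ * (3 / 2 * v - l)) (K * _) (l * u) => c d e.
lra.
Qed.

Lemma vertices_bound : ((24 * 2 ^ kmax) ^ 4 <= y)%N.
Proof.
have [k1 k2] := ku.
rewrite truncn_ge_nat; last exact: ltW.
rewrite expnMn natrM !natrX; apply: le_trans h2.
have : ((2 ^+ kmax) ^+ 4 : R) <= l ^+ 3.
  apply: (@le_trans _ _ (expR (74 / 100 * u) ^+ 4)).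
    apply: ler_expn; first by rewrite exprn_ge0.
    rewrite -natrX; apply: le_trans (natX2_le _ _) _.
    by rewrite ler_expR; move: k1; lra.
  by rewrite lE -!expRM_natl ler_expR; move: u0; lra.
move=> h; apply: (@le_trans _ _ (24 ^+ 4 * l ^+ 3)); last by rewrite lerDl.
by apply: ler_wpM2l => //; rewrite exprn_ge0.
Qed.

Section Sum.
Variables (a N : nat).
Hypothesis hN : expR (3 * v) / 2 <= N%:R :> R.

(** Of the exponent 3 v of N, only 3/4 v is used on the left; all other exponents are
    o(v). *)
Lemma small_conductor_bound :
  (2 ^ size ps * 32)%:R * expR (3 / 4 * v) * (4 ^ y)%:R <= 4 * w * N%:R :> R.
Proof.
have [y1 y2] := ys.
apply: (@le_trans _ _ (expR (74 / 100 * (6 * q) + 37 / 10 + 3 / 4 * v + 148 / 100 * s))).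
  rewrite 2!expRD; apply: ler_pM; rewrite ?mulr_ge0 ?expR_ge0//.
    apply: ler_wpM2r; first exact: expR_ge0.
    rewrite natrM expRD; apply: ler_pM => //.
      apply: le_trans (natX2_le _ _) _; rewrite ler_expR; have := size_primes_bound.
      by lra.
    by apply: le_trans (natX2_le R 5) _; rewrite ler_expR; lra.
  by apply: le_trans (pow4_le y) _; rewrite ler_expR; move: y1; lra.
apply: (@le_trans _ _ (4 * w * (expR (3 * v) / 2))); last first.
  by apply: ler_wpM2l => //; rewrite mulr_ge0// expR_ge0.
apply: (@le_trans _ _ (expR (- (10 * q) + 3 * v))).
  by rewrite ler_expR; move: qv sv v1000; lra.
by rewrite expRD -/w; have := mulr_ge0 (ltW w0) (expR_ge0 (3 * v)); nra.
Qed.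

Lemma twisted_sum_bound D : has D ps -> `|twisted_sum R ps D a N| <= 4 * w * N%:R.
Proof.
move=> Dps; have [n1 n2] := nx; have [y1 y2] := ys.
have ps1 p : p \in ps -> prime p by case/inps.
have ps2 p : p \in ps -> odd p by case/inps.
have ps3 p : p \in ps -> (p <= n)%N by case/inps.
have [YD|YD] := ltP (expR (3 / 4 * v)) (\prod_(p <- ps | D p && (y < p)%N) p)%:R.
  apply: (twisted_sum_large ups ps1 ps2 a _ ps3 w0 w1 _ _ _ _ groups_bound vertices_bound YD).
  - rewrite truncn_ge_nat; last exact: ltW.
    by rewrite xs expr2; move: s2; nra.
  - by apply: le_trans (expR_ge1Dx _); move: v0; lra.
  - apply: le_trans n1 _; rewrite xE ler_expR; move: lv v1000; lra.
  - rewrite -mulrA -expRD.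
    apply: (@le_trans _ _ (expR (3 * v) / 2 * expR (- (v / 100)))); last first.
      by apply: ler_pM pow_w_bound; rewrite ?divr_ge0 ?expR_ge0.
    rewrite [leRHS]mulrAC -expRD.
    have : 4 * expR (3 / 2 * v + 3 / 4 * v) <= expR (3 * v - v / 100).
      apply: (@le_trans _ _ (expR (148 / 100 * 1 + (3 / 2 * v + 3 / 4 * v)))).
        by rewrite [leRHS]expRD; apply: ler_wpM2r; [exact: expR_ge0|exact: (pow4_le 1)].
      by rewrite ler_expR; move: v1000; lra.
    by move: (expR _) (expR (_ - _)) => b c; lra.
  - apply: le_trans n1 _; rewrite xE.
    apply: (@le_trans _ _ (expR (- (v / 100)) ^+ 4 * expR (3 / 4 * v))).
      by rewrite -expRM_natl -expRD ler_expR; move: lv v1000; lra.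
    apply: ler_wpM2r; first exact: expR_ge0.
    by apply: ler_expn pow_w_bound; apply: expR_ge0.
apply: le_trans (twisted_sum_small _ ups ps1 ps2 a N Dps) _.
apply: le_trans small_conductor_bound.
rewrite mulnA natrM -mulrA; apply: ler_wpM2l => //.
rewrite (bigID (fun p => y < p)%N) /= natrM; apply: ler_pM => //.
rewrite ler_nat; apply: leq_trans (nprimorial_le y); rewrite -big_filter.
apply: prod_primes_le_nprimorial; first by rewrite filter_uniq.
by move=> p; rewrite mem_filter -leqNgt => /andP[/andP[_ py] /ps1 pp].
Qed.

End Sum.

(** The lower bound of Chebyshev is e^(c x) with c > 0, and v = o(x). *)
Lemma primorial_large : expR (3 * v) <= (nprimorial n)%:R.
Proof.
have [n1 n2] := nx; have [y1 y2] := ys.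
have n10 : (10 <= n)%N.
  rewrite truncn_ge_nat; last exact: ltW.
  by rewrite xs expr2; move: s2; nra.
pose m := (n %/ 2)%N.
have mn : (2 * m <= n)%N by rewrite mulnC leq_divM.
have nm : (n <= 2 * m + 1)%N by rewrite /m; clear; lia.
have m0 : (0 < m)%N by move: n10 nm; clear; lia.
have my : (2 * m < y.+1 ^ 2)%N.
  rewrite -(ltr_nat R) natrX -natr1; apply: (@le_lt_trans _ _ x).
    by apply: le_trans n1; rewrite ler_nat.
  by rewrite xs !expr2; move: y2 s0; nra.
have := nprimorial_ge m0 my; rewrite -(ler_nat R) natrM => H.
have H2 : expR (1 / 2 * m%:R) <= (nprimorial n)%:R * expR (l * s).
  apply: le_trans (natX2_ge R m) _; apply: le_trans H _.
  apply: ler_pM => //; first by rewrite ler_nat nprimorial_mono.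
  rewrite natrX; apply: (@le_trans _ _ (expR l ^+ y)).
    by apply: ler_expn => //; rewrite -xE; apply: le_trans n1; rewrite ler_nat.
  by rewrite -expRM_natr ler_expR; apply: ler_wpM2l; [exact: ltW|].
rewrite -(ler_pM2r (expR_gt0 (l * s))) -expRD; apply: le_trans H2; rewrite ler_expR.
have ls : l * s <= x / 1000.
  by rewrite -ql mulrC mulrAC; apply: ler_wpM2r; [exact: ltW|].
have vx : 100 * 1000 * v <= x by rewrite -vu mulrC; apply: ler_wpM2l; [exact: ltW|].
have : n%:R <= 2 * m%:R + 1 :> R by rewrite -natrM natr1 ler_nat -addn1.
move: ls vx n2 v1000; move: (l * s) => z; lra.
Qed.

Let density := pattern_density R ps.
Let prime_ps : all prime ps. Proof. by apply/allP => p /inps[]. Qed.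

(** 4^-t / 8 with t at most 6 q. *)
Lemma density_ge : expR (- (9 * q)) / 8 <= density.
Proof.
have pow2 : 2 ^+ size ps <= expR (444 / 100 * q).
  rewrite -natrX; apply: le_trans (natX2_le _ _) _; rewrite ler_expR.
  by have := size_primes_bound; lra.
have p2 : 0 < 2 ^+ size ps :> R by rewrite exprn_gt0.
have inv2 : expR (- (444 / 100 * q)) <= (2 ^+ size ps)^-1.
  by rewrite expRN lef_pV2 ?posrE ?expR_gt0.
have /andP[Q0 _] := prod_oneB_inv_bounds R prime_ps.
have -> : expR (- (9 * q)) = expR (- (444 / 100 * q)) * expR (- (456 / 100 * q)).
  by rewrite -expRD; congr expR; field.
have Q1 : expR (- (456 / 100 * q)) <= \prod_(p <- ps) (1 - p%:R^-1).
  apply: le_trans Q0; rewrite exprVn; apply: le_trans inv2; rewrite ler_expR; move: q0; lra.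
rewrite /density /pattern_density -mulrA; apply: ler_pM; rewrite ?mulr_ge0 ?expR_ge0 ?invr_ge0//.
by rewrite mulrC; apply: ler_wpM2l; rewrite ?invr_ge0.
Qed.

Lemma density_le1 : density <= 1.
Proof.
have p2 : 1 <= 2 ^+ size ps :> R by rewrite exprn_ege1// ler1n.
have /andP[Q0 Q1] := prod_oneB_inv_bounds R prime_ps.
have Q2 : 0 <= \prod_(p <- ps) (1 - p%:R^-1) :> R.
  by apply: le_trans Q0; rewrite exprn_ge0// invr_ge0.
rewrite /density /pattern_density; apply: mulr_ile1.
- by rewrite invr_ge0 (le_trans _ p2).
- by rewrite mulr_ge0 ?invr_ge0.
- by rewrite invf_le1// (lt_le_trans _ p2).
- by move: Q1 Q2; set z := \prod_(_ <- _) _; lra.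
Qed.

Let density_ge0 : 0 <= density.
Proof. by apply: le_trans density_ge; rewrite divr_ge0 ?expR_ge0. Qed.

(** The errors are 4 w M from the character sums, w M from the squares, and at most 1
    from replacing the number M of integers in the interval by its length N. *)
Lemma count_estimate (A N : R) : 0 <= A -> expR (3 * v) <= N ->
  `|(pseudosquare_count x A (A + N))%:R - N * density| <= 11 * w * N.
Proof.
move=> A0 hN.
have N2 : 2 <= N.
  by apply: le_trans hN; apply: le_trans (expR_ge1Dx _); move: v1000; lra.
have N0 : 0 <= N by lra.
set M := (Num.truncn (A + N) - Num.truncn A)%N.
have MN := truncn_interval_length A0 N0; rewrite -/M in MN.
have hM : expR (3 * v) / 2 <= M%:R by move: MN; rewrite ler_norml => /andP[]; lra.
set a := (Num.truncn A).+1.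
have ps1 p : p \in ps -> prime p by case/inps.
have ps2 p : p \in ps -> odd p by case/inps.
have M0 : 0 <= M%:R :> R by [].
have hE : (2 ^ size ps * 32)%:R <= 4 * w * M%:R.
  apply: le_trans (small_conductor_bound hM); rewrite -mulrA ler_peMr//.
  apply: (@le_trans _ _ (1 * 1)); first by rewrite mulr1.
  apply: ler_pM => //; last by rewrite ler1n expn_gt0.
  by apply: le_trans (expR_ge1Dx _); move: v1000; lra.
have := count_residue_pattern ups ps1 ps2 (fun D => @twisted_sum_bound a M hM D) hE.
rewrite -natr_sum; set T := (\sum_(a <= n < a + M) _)%N => hT.
have p2 : 0 < 2 ^+ size ps :> R by rewrite exprn_gt0.
have {}hT : `|T%:R - M%:R * density| <= 4 * w * M%:R.
  rewrite -(ler_pM2l p2); apply: le_trans hT.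
  rewrite -{1}(gtr0_norm p2) -normrM mulrBr /density /pattern_density.
  by rewrite (mulrCA M%:R) (mulrA (2 ^+ _)) divff ?gt_eqF// mul1r.
set m := Num.sqrt (M%:R : R).
have m0 : 0 <= m by apply: sqrtr_ge0.
have mM : m * m = M%:R by rewrite -expr2 sqr_sqrtr.
set r := (Num.truncn m).+1.
have /andP[r1 r2] := truncn_itv m0.
have Mr : (M <= r ^ 2)%N.
  rewrite -(ler_nat R) natrX -mM -expr2; apply: ler_expn => //.
  exact: ltW.
have /andP[c1 c2] := pseudosquare_count_bounds (ltW x0) A0 N0 Mr.
rewrite -/M -/a -/ps -/T in c1 c2.
rewrite -(ler_nat R) in c1; rewrite -(ler_nat R) natrD in c2.
set c := (pseudosquare_count _ _ _)%:R in c1 c2 *.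
have wm : 3 <= w * m.
  have e1 : expR (14 / 10 * v) <= m.
    have e2 : expR (14 / 10 * v) ^+ 2 <= m ^+ 2.
      rewrite [m ^+ 2]expr2 mM; apply: le_trans hM; rewrite -expRM_natl.
      rewrite ler_pdivlMr//; apply: (@le_trans _ _ (expR (2%:R * (14 / 10 * v)) * expR (74 / 100))).
        by apply: ler_wpM2l; [exact: expR_ge0|exact: expR_ge2].
      by rewrite -expRD ler_expR; move: v1000; lra.
    by rewrite leNgt; apply/negP => me; move: e2; rewrite leNgt ltrXn2r// nnegrE expR_ge0.
  apply: (@le_trans _ _ (w * expR (14 / 10 * v))); last by rewrite ler_pM2l.
  rewrite /w -expRD; apply: le_trans (expR_ge1Dx _); move: qv v1000; lra.
have rw : r.+1%:R <= w * M%:R.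
  have m3 : 3 <= m by apply: le_trans wm _; rewrite ler_piMl.
  rewrite -mM mulrA; apply: (@le_trans _ _ (3 * m)); last by rewrite ler_wpM2r.
  by rewrite /r -!natr1; move: r1 m3; lra.
have wM : w * M%:R <= w * N + w.
  rewrite -[X in _ + X]mulr1 -mulrDr ler_pM2l//.
  by move: MN; rewrite ler_norml => /andP[]; lra.
have wN : 1 <= w * N.
  have h : w * (m * m) <= w * N + w by rewrite mM.
  have : 3 * 3 <= w * (m * m).
    rewrite mulrA; apply: ler_pM => //.
    by apply: le_trans wm _; rewrite ler_piMl.
  by move: h w1; lra.
have Md : `|M%:R * density - N * density| <= 1.
  by rewrite -mulrBl normrM; apply: mulr_ile1; rewrite ?normr_ge0// ger0_norm// density_le1.
have -> : 11 * w * N = 11 * (w * N) by rewrite mulrA.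
move: hT; rewrite -(mulrA 4); move: (w * M%:R) (w * N) c rw wM wN Md c1 c2 w1 => wM wN c rw h3 h4 Md c1 c2 w1' hT.
have E : c - N * density = (c - T%:R) + (T%:R - M%:R * density) + (M%:R * density - N * density).
  by ring.
rewrite E; apply: le_trans (ler_normD _ _) _.
apply: le_trans (lerD (ler_normD _ _) Md) _.
have : `|c - T%:R| <= wM by rewrite ler_norml; apply/andP; split; lra.
lra.
Qed.

(** w is at most 8 e^-q times the density. *)
Lemma error_le_density (e : R) : 0 < e -> 88 / e <= l -> 11 * w <= e * density.
Proof.
move=> e0 el.
apply: (@le_trans _ _ (e * (expR (- (9 * q)) / 8))); last first.
  by rewrite ler_pM2l//; exact: density_ge.
have -> : w = expR (- (9 * q)) * expR (- q) by rewrite -expRD; congr expR; ring.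
have lq : l <= q.
  have l3 : l <= l ^+ 3 by rewrite -[X in X <= _]expr1; apply: ler_weXn2l.
  have l4 : l ^+ 3 <= 24 ^+ 4 * l ^+ 3.
    rewrite ler_peMl//; first by rewrite exprn_ge0// ltW.
    by rewrite exprn_ege1//; lra.
  by move: l3 l4 h2 sq q0; move: (24 ^+ 4 * l ^+ 3) (l ^+ 3) => z t; lra.
have ht : 88 * expR (- q) <= e.
  rewrite expRN ler_pdivrMr ?expR_gt0//.
  have h88 : 88 <= e * l by rewrite mulrC -ler_pdivrMr.
  apply: le_trans h88 _; rewrite ler_pM2l//; apply: le_trans lq _.
  by apply: le_trans (expR_ge1Dx q); lra.
have := ler_wpM2l (expR_ge0 (- (9 * q))) ht.
rewrite (mulrCA _ 88) [leRHS]mulrC (mulrA e).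
by move: (expR _ * expR _) (e * expR _) => z t; lra.
Qed.

End Large.

(** * Comparison of two intervals *)

(** c1 and N / M * c0 are both within e * (N * d) of N * d, and N * d is at most 4/3 of
    N / M * c0 as e <= 1/4. *)
Lemma ratio_compare (R : realFieldType) (c1 c0 N M d e eps : R) :
  0 < d -> 0 <= N -> 0 < M -> 0 <= e -> e <= 1 / 4 -> e <= eps / 4 ->
  `|c1 - N * d| <= e * (N * d) -> `|c0 - M * d| <= e * (M * d) ->
  `|c1 - N / M * c0| <= eps * (N / M * c0).
Proof.
move=> d0 N0 M0 e0 e1 e2 h1 h0.
have NM : 0 <= N / M by rewrite divr_ge0// ltW.
have Nd : 0 <= N * d by rewrite mulr_ge0// ltW.
have {}h0 : `|N / M * c0 - N * d| <= e * (N * d).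
  have -> : N / M * c0 - N * d = N / M * (c0 - M * d) by field; rewrite gt_eqF.
  have -> : e * (N * d) = N / M * (e * (M * d)) by field; rewrite gt_eqF.
  by rewrite normrM (ger0_norm NM) ler_wpM2l.
move: h1 h0; move: (N / M * c0) (N * d) Nd => m0 D D0.
rewrite !ler_norml => /andP[a1 a2] /andP[b1 b2].
have l : 3 / 4 * D <= m0.
  have : e * D <= 1 / 4 * D by rewrite ler_wpM2r.
  lra.
have k : 2 * (e * D) <= eps * m0.
  have eps0 : 0 <= eps by lra.
  have : e * D <= eps / 4 * D by rewrite ler_wpM2r.
  have : eps * (3 / 4 * D) <= eps * m0 by rewrite ler_wpM2l.
  have : 0 <= eps * D by rewrite mulr_ge0.
  by move: (eps * m0) (e * D) => z t; lra.
by apply/andP; split; lra.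
Qed.

Theorem theorem1 (R : realType) (eps : R) (eps_gt0 : 0 < eps) :
  exists x0 : R, forall x A N : R,
    x0 <= x -> 0 <= A -> expR (3 * x / ln (ln x)) <= N ->
    let main := N / (primorial x)%:R *
      (pseudosquare_count x 0 (primorial x)%:R)%:R in
    `|(pseudosquare_count x A (A + N))%:R - main| <= eps * main.
Proof.
pose e := Num.min (1 / 4) (eps / 4).
have e0 : 0 < e by rewrite lt_min; apply/andP; split; lra.
(* The two summands give log log x >= 10^5 and log x >= 88 / e. *)
exists (expR (expR (100 * 1000)) + expR (88 / e)) => x A N hx A0 hN /=.
have x0 : 0 < x.
  by apply: lt_le_trans hx; rewrite addr_gt0 ?expR_gt0.
set l := ln x; have xE : x = expR l by rewrite /l lnK// posrE.
have l1 : expR (100 * 1000) <= l.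
  rewrite -ler_expR -xE; apply: le_trans hx.
  by rewrite lerDl expR_ge0.
have l2 : 88 / e <= l.
  rewrite -ler_expR -xE; apply: le_trans hx.
  by rewrite lerDr expR_ge0.
have l0 : 0 < l by apply: lt_le_trans l1; apply: expR_gt0.
set u := ln l; have lE : l = expR u by rewrite /u lnK// posrE.
have hu : 100 * 1000 <= u by rewrite -ler_expR -lE.
have := scale_inequalities hu; cbv zeta; rewrite -lE -xE.
set s := expR (l / 2); set v := x / u; set q := x / l.
move=> [[h1 h2 xs] [v1000 qv sv sq lv]].
have u0 : 0 < u by lra.
have vu : v * u = x by rewrite /v divfK ?gt_eqF.
have ql : q * l = x by rewrite /q divfK ?gt_eqF.
have est := count_estimate hu lE (erefl s) xE vu ql h1 h2 xs v1000 qv sv sq lv.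
have dge := density_ge hu lE (erefl s) xE ql h2 sq.
have pl := primorial_large hu lE (erefl s) xE vu ql h2 xs v1000 sq.
set d := (X in _ <= X) in dge; rewrite -/d in est.
have d0 : 0 < d by apply: lt_le_trans dge; rewrite divr_gt0 ?expR_gt0.
have wd : 11 * expR (- (10 * q)) <= e * d.
  exact: (error_le_density hu lE (erefl s) xE ql h2 sq e0 l2).
have L3 : 3 * x / u = 3 * v by rewrite /v mulrA.
rewrite L3 in hN.
have bnd A' N' : 0 <= A' -> expR (3 * v) <= N' ->
    `|(pseudosquare_count x A' (A' + N'))%:R - N' * d| <= e * (N' * d).
  move=> A'0 hN'; apply: le_trans (est A' N' A'0 hN') _.
  have N'0 : 0 <= N' by apply: le_trans hN'; apply: expR_ge0.
  by rewrite [leRHS]mulrCA [leRHS]mulrC ler_wpM2r.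
have b0 := bnd 0 _ (lexx 0) pl; rewrite add0r in b0.
apply: (ratio_compare d0 _ _ (ltW e0) _ _ (bnd A N A0 hN) b0).
- by apply: le_trans hN; apply: expR_ge0.
- by apply: lt_le_trans pl; apply: expR_gt0.
- by rewrite /e ge_min lexx.
- by rewrite /e ge_min lexx orbT.
Qed.
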